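(* Let $S$ be the curve $(2x-y)(y+x^2)(y-x^2)=0$. Its local braid monodromy $\beta$ at $(0,0)$ is: the two points $y=1$ and $y=-1$ of the fiber over $x=1$ do two counterclockwise full-twists, and the third point $y=2$ does a counterclockwise full-twist around them. That is, $\beta$ is the braid induced by the motion in which first $\pm1$ rotate about $0$ by the angle $4\pi$ counterclockwise with $2$ fixed, and then $2$ makes one full counterclockwise revolution along the circle $|y|=2$ with $\pm1$ fixed. The induced relations are $$x_3x_2x_1=x_2x_1x_3,\qquad x_3x_2x_1x_2x_1=x_1x_3x_2x_1x_2,$$ where $\{x_1,x_2,x_3\}$ are the generators of the standard g-base.
   Context: Let $E=\{x\in\mathbb{C}:|x|\le 1\}$, $D=\{y\in\mathbb{C}:|y|\le 4\}$, and regard $S$ as a curve in $E\times D$. The projection of $S$ to $E$ has fibers of constant cardinality $n$ ($n=3$ here) except over $x=0$. Let $K\subset D$ be the set of $y$-coordinates of the points of $S$ over $x=1$. A motion of $K$ in $D$ consists of $n$ continuous functions $m_i:[0,1]\to D$ with $m_i(t)\ne m_j(t)$ for all $t$ and $i\neq j$, and $\{m_i(0)\}=\{m_i(1)\}=K$. It is realized by a continuous family of diffeomorphisms $D_t$ of $D$, $D_0=\mathrm{Id}$, equal to the identity on $\partial D$, with $D_t(m_i(0))=m_i(t)$; the braid induced by the motion is the class of $D_1$ in the braid group $B_n[D,K]$, the group of diffeomorphisms of $D$ preserving $K$ and equal to the identity on $\partial D$, two being identified if they induce the same automorphism of $\pi_1(D-K,u_0)$. The local braid monodromy $\beta$ of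 $S$ at $(0,0)$ is the braid induced by the motion formed by the points of $S$ over $x=e^{2\pi i t}$, $0\le t\le 1$. Standard g-base: take the base point $u_0=-4i$ and let $p_1<\dots<p_n$ be the (real) points of $K$. The loop $x_i$ goes from $u_0$ along the straight segment to near $p_i$, once counterclockwise around $p_i$ on a small circle, and back. In a product of loops the left factor is traversed first. The group $\pi_1(D-K,u_0)$ is free on $x_1,\dots,x_n$. The relations induced by $\beta$ are $\beta(x_j)=x_j$, $j=1,\dots,n$. Saying that ''the induced relations are $R$'' means that $R$ and $\{\beta(x_j)=x_j\}_j$ have the same normal closure in the free group on $x_1,\dots,x_n$. *)

(* Defs.v *)
From Stdlib Require Import Reals.
From Coquelicot Require Import Coquelicot.
Open Scope R_scope.

Definition unit_interval (t : R) : Prop := 0 <= t <= 1.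

Definition cis (theta : R) : C := (cos theta, sin theta).

Definition E (x : C) : Prop := Cmod x <= 1.
Definition D (y : C) : Prop := Cmod y <= 4.
Definition bdD (y : C) : Prop := Cmod y = 4.
Definition u0 : C := (0, -4).

(** A path is a function of which only the restriction to [0,1] matters;
    likewise a self-map of [D] is a function of which only the restriction
    to [D] matters. *)

Definition path_concat (a b : R -> C) (t : R) : C :=
  if Rle_dec t (1/2) then a (2 * t) else b (2 * t - 1).

Definition path_inv (a : R -> C) (t : R) : C := a (1 - t).

Definition segment (a b : C) (t : R) : C := (a + RtoC t * (b - a))%C.

(** Elements of pi_1(X, u) are loops taken up to [homotopic]. *)

Definition is_loop (X : C -> Prop) (u : C) (g : R -> C) : Prop :=
  continuous_on unit_interval g /\
  (forall t, unit_interval t -> X (g t)) /\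
  g 0 = u /\ g 1 = u.

Definition homotopic (X : C -> Prop) (u : C) (g h : R -> C) : Prop :=
  exists H : R * R -> C,
    continuous_on (fun q : R * R => unit_interval (fst q) /\ unit_interval (snd q)) H /\
    (forall s, unit_interval s -> is_loop X u (fun t => H (s, t))) /\
    (forall t, unit_interval t -> H (0, t) = g t) /\
    (forall t, unit_interval t -> H (1, t) = h t).

(** The relation [a = b], read as the element [a b^-1]. *)
Definition relator (a b : R -> C) : R -> C := path_concat a (path_inv b).

(** [normal_closure X u P g]: the class of the loop [g] lies in the normal
    closure in pi_1(X, u) of the classes of the loops satisfying [P]. *)
Inductive normal_closure (X : C -> Prop) (u : C) (P : (R -> C) -> Prop) :
    (R -> C) -> Prop :=
| nc_gen : forall g, is_loop X u g -> P g -> normal_closure X u P g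
| nc_one : normal_closure X u P (fun _ => u)
| nc_mul : forall g h, normal_closure X u P g -> normal_closure X u P h ->
    normal_closure X u P (path_concat g h)
| nc_inv : forall g, normal_closure X u P g -> normal_closure X u P (path_inv g)
| nc_conj : forall c g, is_loop X u c -> normal_closure X u P g ->
    normal_closure X u P (path_concat (path_concat c g) (path_inv c))
| nc_class : forall g h, normal_closure X u P g -> homotopic X u g h ->
    normal_closure X u P h.

Definition same_normal_closure (X : C -> Prop) (u : C)
    (P Q : (R -> C) -> Prop) : Prop :=
  forall g, normal_closure X u P g <-> normal_closure X u Q g.

(** Smoothness on a set which need not be open: existence of a C^infinity
    extension to an open neighbourhood, in the two real coordinates. *)
Definition smooth_on (A : C -> Prop) (f : C -> C) : Prop :=
  exists (U : C -> Prop) (F : C -> C),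
    open U /\ (forall z, A z -> U z) /\ (forall z, A z -> F z = f z) /\
    (forall z n, U z ->
       ex_diff_n (fun a b => fst (F (a, b))) n (fst z) (snd z) /\
       ex_diff_n (fun a b => snd (F (a, b))) n (fst z) (snd z)).

Definition is_diffeo (f : C -> C) : Prop :=
  (forall z, D z -> D (f z)) /\ smooth_on D f /\
  exists g : C -> C,
    (forall z, D z -> D (g z)) /\ smooth_on D g /\
    (forall z, D z -> g (f z) = z) /\ (forall z, D z -> f (g z) = z).

Definition is_diffeo_rel_boundary (f : C -> C) : Prop :=
  is_diffeo f /\ (forall z, bdD z -> f z = z).

Definition punctured (K : C -> Prop) (z : C) : Prop := D z /\ ~ K z.

(** A braid is given by a representing diffeomorphism, taken up to [same_braid]. *)
Definition braid_rep (K : C -> Prop) (f : C -> C) : Prop :=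
  is_diffeo_rel_boundary f /\ (forall z, D z -> (K z <-> K (f z))).

Definition act (f : C -> C) (g : R -> C) : R -> C := fun t => f (g t).

Definition same_braid (K : C -> Prop) (f f' : C -> C) : Prop :=
  braid_rep K f /\ braid_rep K f' /\
  forall g, is_loop (punctured K) u0 g ->
    homotopic (punctured K) u0 (act f g) (act f' g).

(** The points of a motion are indexed by 1, ..., n. *)

Definition is_motion (n : nat) (K : C -> Prop) (m : nat -> R -> C) : Prop :=
  (forall i, (1 <= i <= n)%nat ->
     continuous_on unit_interval (m i) /\
     (forall t, unit_interval t -> D (m i t))) /\
  (forall i j t, (1 <= i <= n)%nat -> (1 <= j <= n)%nat -> i <> j ->
     unit_interval t -> m i t <> m j t) /\
  (forall y, K y <-> exists i, (1 <= i <= n)%nat /\ y = m i 0) /\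
  (forall y, K y <-> exists i, (1 <= i <= n)%nat /\ y = m i 1).

Definition realizes (n : nat) (m : nat -> R -> C) (Dt : R -> C -> C) : Prop :=
  continuous_on (fun q : R * C => unit_interval (fst q) /\ D (snd q))
    (fun q : R * C => Dt (fst q) (snd q)) /\
  (forall t, unit_interval t -> is_diffeo_rel_boundary (Dt t)) /\
  (forall z, D z -> Dt 0 z = z) /\
  (forall i t, (1 <= i <= n)%nat -> unit_interval t -> Dt t (m i 0) = m i t).

Definition induced_braid (n : nat) (K : C -> Prop) (m : nat -> R -> C)
    (b : C -> C) : Prop :=
  is_motion n K m /\
  exists Dt, realizes n m Dt /\ same_braid K b (Dt 1).

Definition fibre (S : C -> C -> Prop) (x y : C) : Prop := E x /\ D y /\ S x y.

Definition local_braid_monodromy (n : nat) (S : C -> C -> Prop) (b : C -> C) : Prop :=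
  exists m,
    (forall t y, unit_interval t ->
       (fibre S (cis (2 * PI * t)) y <-> exists i, (1 <= i <= n)%nat /\ y = m i t)) /\
    induced_braid n (fibre S (RtoC 1)) m b.

Definition ordered_real_points (n : nat) (K : C -> Prop) (p : nat -> R) : Prop :=
  (forall i j, (1 <= i)%nat -> (i < j)%nat -> (j <= n)%nat -> p i < p j) /\
  (forall y, K y <-> exists i, (1 <= i <= n)%nat /\ y = RtoC (p i)).

(** The closed discs of radius [r] about the points of [K] are disjoint and
    lie in the interior of [D]. *)
Definition small_radius (K : C -> Prop) (r : R) : Prop :=
  0 < r /\
  (forall p, K p -> Cmod p + r < 4) /\
  (forall p q, K p -> K q -> p <> q -> 2 * r < Cmod (p - q)%C).

(** [q] is the point of the segment from [u0] to [p] at distance [r] from [p]. *)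
Definition gbase_loop (r : R) (p : C) : R -> C :=
  let q := (p + RtoC (r / Cmod (u0 - p)) * (u0 - p))%C in
  path_concat
    (path_concat (segment u0 q) (fun t => (p + (q - p) * cis (2 * PI * t))%C))
    (path_inv (segment u0 q)).

Definition induced_relators (n : nat) (b : C -> C) (x : nat -> R -> C)
    (g : R -> C) : Prop :=
  exists j, (1 <= j <= n)%nat /\ g = relator (act b (x j)) (x j).

Definition S_curve (x y : C) : Prop :=
  ((RtoC 2 * x - y) * (y + x * x) * (y - x * x))%C = RtoC 0.

Definition K_fibre : C -> Prop := fibre S_curve (RtoC 1).

(** Points 1 and 2 rotate about 0 by the angle 4 pi, point 3 being fixed;
    then point 3 makes one revolution, points 1 and 2 being fixed. *)
Definition twist_motion (i : nat) : R -> C :=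
  match i with
  | 1%nat => path_concat (fun t => (- cis (4 * PI * t))%C) (fun _ => RtoC (-1))
  | 2%nat => path_concat (fun t => cis (4 * PI * t)) (fun _ => RtoC 1)
  | _ => path_concat (fun _ => RtoC 2) (fun t => (RtoC 2 * cis (2 * PI * t))%C)
  end.

Definition stated_relators (x : nat -> R -> C) (g : R -> C) : Prop :=
  let x1 := x 1%nat in let x2 := x 2%nat in let x3 := x 3%nat in
  let mul := path_concat in
  g = relator (mul (mul x3 x2) x1) (mul (mul x2 x1) x3) \/
  g = relator (mul (mul (mul (mul x3 x2) x1) x2) x1)
              (mul (mul (mul (mul x1 x3) x2) x1) x2).

(* Main.v *)
Require Import Defs.
From Stdlib Require Import Reals Lra Lia List Setoid Morphisms.
From Coquelicot Require Import Coquelicot.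
Import Defs ListNotations.
Open Scope R_scope.

(** The monodromy rotates the points 1, -1 by 4 pi t and the point 2 by 2 pi t,
    so it is realized by the radial twists y |-> y cis(theta_t(|y|)), with
    theta_t(1) = 4 pi t, theta_t(2) = 2 pi t and theta_t(4) = 0. The twist motion
    is realized by other radial twists with the same final map beta, and two
    isotopies that carry K along the same sets have homotopic final actions.

    Only the values of the rotation angle on the circles through K and on the
    boundary matter for the action of beta on loops. Take the angle to be 4 pi
    on a disc containing -1 and 1, 2 pi on a ring containing 2, and let it vary
    in between. A path from the base point to the ring then acquires the
    boundary loop d = x3 x2 x1, and a path on to the inner disc acquires also the
    loop s = x2 x1 around -1 and 1. Hence beta(x3) = d x3 d^-1 and
    beta(xi) = (d s) xi (d s)^-1 for i = 1, 2. The relations say that x3 commutes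
    with s, and x1 (hence also x2) with x3 s s. *)

(** * Paths and homotopies *)

(** The order x3 x2 x1 comes from the base point: the counterclockwise boundary circle leaves -4i to
    the right, so it meets the loop around 2 before those around 1 and -1. Between boundary and ring
    a spoke makes one turn; carried out at the base point, that turn is the boundary circle. Between
    ring and inner disc it makes a second turn; carried out at the inner end, this is a circle
    around -1 and 1, which conjugates the inner loops. Hence the order of the factors in d s. The
    obstacle is that equalities of loops in the punctured disc have to come from actual homotopies.
    Those between explicit paths are reduced to straight-line homotopies in a convex set, pushed
    forward along a continuous map. For polygons the convex sets are triangles missing -1, 1 and 2,
    so that an equality of loops becomes a list of insertions and deletions of vertices, each
    settled by linear arithmetic. The locally constant angle is only continuous, which suffices for
    acting on paths; the diffeomorphisms themselves have polynomial angles. *)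

Lemma continuous_pair {T U V : UniformSpace} (f : T -> U) (g : T -> V) x :
  continuous f x -> continuous g x -> continuous (fun y => (f y, g y)) x.
Proof.
intros Hf Hg; apply (continuous_comp_2 f g (fun u v => (u, v))); auto.
apply continuous_ext with (fun q : U * V => q); [now intros [u v]|apply continuous_id].
Qed.

(** Composition with this retraction turns a function continuous on [0,1] into one continuous on the
    whole line, to which unconditional continuity rules apply. *)
Definition clamp (t : R) : R := Rmax 0 (Rmin 1 t).

Lemma clamp_in t : unit_interval (clamp t).
Proof. unfold clamp, unit_interval, Rmax, Rmin; repeat destruct Rle_dec; lra. Qed.

Lemma clamp_id t : unit_interval t -> clamp t = t.
Proof. unfold clamp, unit_interval, Rmax, Rmin; repeat destruct Rle_dec; lra. Qed.

Lemma clamp_ge t : 1 <= t -> clamp t = 1.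
Proof. unfold clamp, unit_interval, Rmax, Rmin; repeat destruct Rle_dec; lra. Qed.

Lemma clamp_le t : t <= 0 -> clamp t = 0.
Proof. unfold clamp, unit_interval, Rmax, Rmin; repeat destruct Rle_dec; lra. Qed.

Lemma clamp_lip s t : Rabs (clamp s - clamp t) <= Rabs (s - t).
Proof.
unfold clamp, Rmax, Rmin, Rabs; repeat destruct Rle_dec; repeat destruct Rcase_abs; lra.
Qed.

Section RealContinuity.
Context {T : UniformSpace}.
Implicit Types (f g : T -> R) (F G : T -> C) (x : T).

Lemma cont_Rplus f g x : continuous f x -> continuous g x -> continuous (fun y => f y + g y) x.
Proof. exact (continuous_plus f g x). Qed.
Lemma cont_Rminus f g x : continuous f x -> continuous g x -> continuous (fun y => f y - g y) x.
Proof. exact (continuous_minus f g x). Qed.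
Lemma cont_Ropp f x : continuous f x -> continuous (fun y => - f y) x.
Proof. exact (continuous_opp f x). Qed.
Lemma cont_Rmult f g x : continuous f x -> continuous g x -> continuous (fun y => f y * g y) x.
Proof. exact (continuous_mult f g x). Qed.
Lemma cont_cos f x : continuous f x -> continuous (fun y => cos (f y)) x.
Proof. intros H; apply (continuous_comp f cos); [exact H|apply continuous_cos]. Qed.
Lemma cont_sin f x : continuous f x -> continuous (fun y => sin (f y)) x.
Proof. intros H; apply (continuous_comp f sin); [exact H|apply continuous_sin]. Qed.
Lemma cont_clamp f x : continuous f x -> continuous (fun y => clamp (f y)) x.
Proof.
intros H; apply (continuous_comp f clamp); [exact H|].
apply filterlim_locally; intros eps; exists eps; intros y Hy.
apply Rle_lt_trans with (2 := Hy), clamp_lip.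
Qed.
Lemma cont_fst {U V : UniformSpace} (f : T -> U * V) x :
  continuous f x -> continuous (fun y => fst (f y)) x.
Proof.
intros H; apply (continuous_comp f fst); [exact H|destruct (f x); apply continuous_fst].
Qed.
Lemma cont_snd {U V : UniformSpace} (f : T -> U * V) x :
  continuous f x -> continuous (fun y => snd (f y)) x.
Proof.
intros H; apply (continuous_comp f snd); [exact H|destruct (f x); apply continuous_snd].
Qed.
Lemma cont_Cplus F G x : continuous F x -> continuous G x -> continuous (fun y => F y + G y)%C x.
Proof.
intros HF HG; apply (continuous_pair (fun y => fst (F y) + fst (G y)) (fun y => snd (F y) + snd (G y)));
  apply cont_Rplus; now (apply cont_fst || apply cont_snd).
Qed.
Lemma cont_Copp F x : continuous F x -> continuous (fun y => - F y)%C x.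
Proof.
intros HF; apply (continuous_pair (fun y => - fst (F y)) (fun y => - snd (F y)));
  apply cont_Ropp; now (apply cont_fst || apply cont_snd).
Qed.
Lemma cont_Cminus F G x : continuous F x -> continuous G x -> continuous (fun y => F y - G y)%C x.
Proof. intros HF HG; apply cont_Cplus; [exact HF|now apply cont_Copp]. Qed.
Lemma cont_Cmult F G x : continuous F x -> continuous G x -> continuous (fun y => F y * G y)%C x.
Proof.
intros HF HG.
apply (continuous_pair (fun y => fst (F y) * fst (G y) - snd (F y) * snd (G y))
         (fun y => fst (F y) * snd (G y) + snd (F y) * fst (G y)));
  [apply cont_Rminus|apply cont_Rplus]; apply cont_Rmult; now (apply cont_fst || apply cont_snd).
Qed.
Lemma cont_RtoC f x : continuous f x -> continuous (fun y => RtoC (f y)) x.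
Proof. intros H; apply (continuous_pair f (fun _ => 0)); [exact H|apply continuous_const]. Qed.
Lemma cont_cis f x : continuous f x -> continuous (fun y => cis (f y)) x.
Proof.
intros H; apply (continuous_pair (fun y => cos (f y)) (fun y => sin (f y)));
  [now apply cont_cos|now apply cont_sin].
Qed.
End RealContinuity.

Ltac cont1 := lazymatch goal with
  | |- continuous (fun _ => ?c) _ => apply continuous_const
  | |- continuous (fun y => y) _ => apply continuous_id
  | |- continuous fst _ => apply (cont_fst (fun y => y)), continuous_id
  | |- continuous snd _ => apply (cont_snd (fun y => y)), continuous_id
  | |- continuous (fun y => (@?f y + @?g y)%R) _ => apply (cont_Rplus f g)
  | |- continuous (fun y => (@?f y - @?g y)%R) _ => apply (cont_Rminus f g)
  | |- continuous (fun y => (@?f y * @?g y)%R) _ => apply (cont_Rmult f g)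
  | |- continuous (fun y => (- @?f y)%R) _ => apply (cont_Ropp f)
  | |- continuous (fun y => cos (@?f y)) _ => apply (cont_cos f)
  | |- continuous (fun y => sin (@?f y)) _ => apply (cont_sin f)
  | |- continuous (fun y => clamp (@?f y)) _ => apply (cont_clamp f)
  | |- continuous (fun y => (@?f y + @?g y)%C) _ => apply (cont_Cplus f g)
  | |- continuous (fun y => (@?f y - @?g y)%C) _ => apply (cont_Cminus f g)
  | |- continuous (fun y => (@?f y * @?g y)%C) _ => apply (cont_Cmult f g)
  | |- continuous (fun y => (- @?f y)%C) _ => apply (cont_Copp f)
  | |- continuous (fun y => RtoC (@?f y)) _ => apply (cont_RtoC f)
  | |- continuous (fun y => cis (@?f y)) _ => apply (cont_cis f)
  | |- continuous (fun y => (@?f y, @?g y)) _ => apply (continuous_pair f g)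
  | |- continuous (fun y => fst (@?f y)) _ => apply (cont_fst f)
  | |- continuous (fun y => snd (@?f y)) _ => apply (cont_snd f)
  | H : forall x, continuous ?g x |- continuous (fun q => ?g (@?f q)) _ =>
      apply (continuous_comp f g); [|apply H]
  end.
Ltac cont := intros; repeat cont1; auto.

Lemma continuous_on_comp {T U V : UniformSpace} (A : T -> Prop) (B : U -> Prop)
    (f : T -> U) (g : U -> V) :
  continuous_on A f -> (forall x, A x -> B (f x)) -> continuous_on B g ->
  continuous_on A (fun x => g (f x)).
Proof.
intros Hf HAB Hg x Hx; refine (filterlim_comp _ _ _ f g _ _ _ _ (Hg _ (HAB _ Hx))).
intros P HP; unfold filtermap, within in *.
specialize (Hf x Hx _ HP); unfold filtermap, within in Hf.
revert Hf; apply filter_imp; intros y Hy Ay; apply Hy; auto.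
Qed.

(** Discharges relative continuity once the inner map, typically built with [clamp], takes all its
    values in [B]. *)
Lemma continuous_of_on {T U V : UniformSpace} (B : U -> Prop) (f : T -> U) (g : U -> V) :
  (forall x, continuous f x) -> (forall x, B (f x)) -> continuous_on B g ->
  forall x, continuous (fun y => g (f y)) x.
Proof.
intros Hf HB Hg x P HP.
pose proof (continuous_on_comp (fun _ => True) B f g (continuous_on_forall _ _ (fun y _ => Hf y))
  (fun y _ => HB y) Hg x I P HP) as H; unfold filtermap, within in *.
revert H; apply filter_imp; auto.
Qed.

Lemma unit_0 : unit_interval 0. Proof. unfold unit_interval; lra. Qed.
Lemma unit_1 : unit_interval 1. Proof. unfold unit_interval; lra. Qed.
#[local] Hint Resolve unit_0 unit_1 clamp_in : core.

Definition is_path (X : C -> Prop) (a b : C) (g : R -> C) : Prop :=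
  continuous_on unit_interval g /\
  (forall t, unit_interval t -> X (g t)) /\ g 0 = a /\ g 1 = b.

(** Homotopy relative to the endpoints. By conversion, [is_loop X u] is
    [is_path X u u] and [homotopic X u] is [path_homotopic X u u]. *)
Definition path_homotopic (X : C -> Prop) (a b : C) (g h : R -> C) : Prop :=
  exists H : R * R -> C,
    continuous_on (fun q : R * R => unit_interval (fst q) /\ unit_interval (snd q)) H /\
    (forall s, unit_interval s -> is_path X a b (fun t => H (s, t))) /\
    (forall t, unit_interval t -> H (0, t) = g t) /\
    (forall t, unit_interval t -> H (1, t) = h t).

Section Paths.
Variable X : C -> Prop.

Lemma is_path_ext a b g h :
  (forall t, unit_interval t -> g t = h t) -> is_path X a b g -> is_path X a b h.
Proof.
intros E (H1 & H2 & H3 & H4); repeat split.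
- now apply continuous_on_ext with (2 := H1).
- intros t Ht; rewrite <- E; auto.
- rewrite <- E; auto.
- rewrite <- E; auto.
Qed.

Lemma is_path_intro a b g : (forall t, continuous g t) ->
  (forall t, unit_interval t -> X (g t)) -> g 0 = a -> g 1 = b -> is_path X a b g.
Proof. intros; repeat split; auto; apply continuous_on_forall; auto. Qed.

Lemma is_path_clamp a b g : is_path X a b g -> forall t, continuous (fun t => g (clamp t)) t.
Proof.
intros (H & _); apply continuous_of_on with (3 := H); auto.
intros; apply cont_clamp, continuous_id.
Qed.

Lemma path_homotopic_intro a b g h (H : R -> R -> C) :
  (forall q : R * R, continuous (fun q => H (fst q) (snd q)) q) ->
  (forall s t, unit_interval s -> unit_interval t -> X (H s t)) ->
  (forall s, unit_interval s -> H s 0 = a) ->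
  (forall s, unit_interval s -> H s 1 = b) ->
  (forall t, unit_interval t -> H 0 t = g t) ->
  (forall t, unit_interval t -> H 1 t = h t) -> path_homotopic X a b g h.
Proof.
intros HC HX Ha Hb Hg Hh; exists (fun q => H (fst q) (snd q)); repeat split; auto; simpl; auto.
- now apply continuous_on_forall.
- apply continuous_on_forall; intros t _.
  apply (continuous_comp (fun t => (s, t)) (fun q => H (fst q) (snd q))); [cont|apply HC].
Qed.

(** Precomposing with [clamp] makes the homotopy continuous on the whole plane. *)
Lemma path_homotopic_elim a b g h : path_homotopic X a b g h -> exists H : R -> R -> C,
  (forall q : R * R, continuous (fun q => H (fst q) (snd q)) q) /\
  (forall s t, X (H s t)) /\ (forall s, H s 0 = a) /\ (forall s, H s 1 = b) /\
  (forall t, unit_interval t -> H 0 t = g t) /\ (forall t, unit_interval t -> H 1 t = h t).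
Proof.
intros (H & HC & HP & Hg & Hh); exists (fun s t => H (clamp s, clamp t)); repeat split.
- apply (continuous_of_on (fun q : R * R => unit_interval (fst q) /\ unit_interval (snd q))
    (fun q : R * R => (clamp (fst q), clamp (snd q)))); simpl; auto; cont.
- intros s t; apply (HP (clamp s)); auto.
- intros s; rewrite (clamp_id 0) by auto; apply (HP (clamp s)); auto.
- intros s; rewrite (clamp_id 1) by auto; apply (HP (clamp s)); auto.
- intros t Ht; rewrite 2!clamp_id; auto.
- intros t Ht; rewrite 2!clamp_id; auto.
Qed.

Lemma path_homotopic_is_path a b g h :
  path_homotopic X a b g h -> is_path X a b g /\ is_path X a b h.
Proof.
intros (H & _ & HP & Hg & Hh); split.
- apply is_path_ext with (2 := HP 0 unit_0); auto.
- apply is_path_ext with (2 := HP 1 unit_1); auto.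
Qed.

Lemma path_homotopic_ext a b g h : is_path X a b g ->
  (forall t, unit_interval t -> g t = h t) -> path_homotopic X a b g h.
Proof.
intros Hg E; pose proof (is_path_clamp _ _ _ Hg).
destruct Hg as (Hg & HX & Ha & Hb).
apply path_homotopic_intro with (fun s t => g (clamp t)).
- intros; apply (continuous_comp (fun q : R * R => snd q) (fun t => g (clamp t))); auto; cont.
- auto.
- intros; rewrite clamp_id; auto.
- intros; rewrite clamp_id; auto.
- intros; rewrite clamp_id; auto.
- intros; rewrite clamp_id; auto.
Qed.

Lemma path_homotopic_refl a b g : is_path X a b g -> path_homotopic X a b g g.
Proof. intros; apply path_homotopic_ext; auto. Qed.

Lemma path_homotopic_sym a b g h : path_homotopic X a b g h -> path_homotopic X a b h g.
Proof.
intros HH; destruct (path_homotopic_elim _ _ _ _ HH) as (H & HC & HX & Ha & Hb & Hg & Hh).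
apply path_homotopic_intro with (fun s t => H (1 - s) t); auto.
- intros; apply (continuous_comp (fun q : R * R => (1 - fst q, snd q)) (fun q => H (fst q) (snd q))); auto; cont.
- intros; replace (1 - 0) with 1 by lra; auto.
- intros; replace (1 - 1) with 0 by lra; auto.
Qed.

(** The two homotopies are glued as [H (2s) + K (2s-1) - h] with clamped
    arguments, so that continuity needs no case analysis. *)
Lemma path_homotopic_trans a b g h k :
  path_homotopic X a b g h -> path_homotopic X a b h k -> path_homotopic X a b g k.
Proof.
intros HH HK; destruct (path_homotopic_elim _ _ _ _ HH) as (H & HC & HX & Ha & Hb & Hg & Hh).
destruct (path_homotopic_elim _ _ _ _ HK) as (K & KC & KX & Ka & Kb & Kh & Kk).
set (L := fun s t => (H (clamp (2 * s)) (clamp t) + (K (clamp (2 * s - 1)) (clamp t) - K 0 (clamp t)))%C).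
assert (E1 : forall s t, unit_interval t -> s <= 1/2 -> L s t = H (clamp (2 * s)) t).
{ intros s t Ht Hs; unfold L; rewrite (clamp_le (2 * s - 1)), (clamp_id t); auto; [ring|lra]. }
assert (E2 : forall s t, unit_interval t -> 1/2 <= s -> L s t = K (clamp (2 * s - 1)) t).
{ intros s t Ht Hs; unfold L; rewrite (clamp_ge (2 * s)), (clamp_id t), Hh, Kh; auto; [ring|lra]. }
apply path_homotopic_intro with L.
- unfold L; intros; apply cont_Cplus; [|apply cont_Cminus].
  + apply (continuous_comp (fun q : R * R => (clamp (2 * fst q), clamp (snd q))) (fun q => H (fst q) (snd q))); auto; cont.
  + apply (continuous_comp (fun q : R * R => (clamp (2 * fst q - 1), clamp (snd q))) (fun q => K (fst q) (snd q))); auto; cont.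
  + apply (continuous_comp (fun q : R * R => (0, clamp (snd q))) (fun q => K (fst q) (snd q))); auto; cont.
- intros s t Hs Ht; destruct (Rle_dec s (1/2)); [rewrite E1|rewrite E2]; auto; lra.
- intros s Hs; destruct (Rle_dec s (1/2)); [rewrite E1|rewrite E2]; auto; lra.
- intros s Hs; destruct (Rle_dec s (1/2)); [rewrite E1|rewrite E2]; auto; lra.
- intros t Ht; rewrite E1, clamp_le, Hg; auto; lra.
- intros t Ht; rewrite E2, clamp_ge, Kk; auto; lra.
Qed.

Lemma path_concat_first a b g h t : is_path X a b g -> h 0 = b -> t <= 1/2 ->
  path_concat g h t = g (2 * t).
Proof. intros; unfold path_concat; destruct Rle_dec; auto; lra. Qed.

Lemma path_concat_second a b g h t : is_path X a b g -> h 0 = b -> 1/2 <= t ->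
  path_concat g h t = h (2 * t - 1).
Proof.
intros (_ & _ & _ & Hg) Hh Ht; unfold path_concat; destruct Rle_dec; auto.
replace t with (1/2) by lra; replace (2 * (1/2)) with 1 by lra.
replace (1 - 1) with 0 by lra; congruence.
Qed.

Lemma path_homotopic_concat a b c g g' h h' :
  path_homotopic X a b g g' -> path_homotopic X b c h h' ->
  path_homotopic X a c (path_concat g h) (path_concat g' h').
Proof.
intros HH HK; destruct (path_homotopic_elim _ _ _ _ HH) as (H & HC & HX & Ha & Hb & Hg & Hg').
destruct (path_homotopic_elim _ _ _ _ HK) as (K & KC & KX & Kb & Kc & Kh & Kh').
destruct (path_homotopic_is_path _ _ _ _ HH) as (Pg & Pg').
destruct (path_homotopic_is_path _ _ _ _ HK) as ((_ & _ & Ph & _) & _ & _ & Ph' & _).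
(* Additive gluing again, now in [t]: outside its own half of the interval each of the two paths is
   frozen at the junction [b], which the subtraction cancels. *)
set (L := fun s t => (H (clamp s) (clamp (2 * t)) + (K (clamp s) (clamp (2 * t - 1)) - b))%C).
assert (E1 : forall s t, t <= 1/2 -> L s t = H (clamp s) (clamp (2 * t))).
{ intros s t Ht; unfold L; rewrite (clamp_le (2 * t - 1)), Kb; auto; [ring|lra]. }
assert (E2 : forall s t, 1/2 <= t -> L s t = K (clamp s) (clamp (2 * t - 1))).
{ intros s t Ht; unfold L; rewrite (clamp_ge (2 * t)), Hb; auto; [ring|lra]. }
apply path_homotopic_intro with L.
- unfold L; intros; apply cont_Cplus; [|apply cont_Cminus; [|apply continuous_const]].
  + apply (continuous_comp (fun q : R * R => (clamp (fst q), clamp (2 * snd q))) (fun q => H (fst q) (snd q))); auto; cont.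
  + apply (continuous_comp (fun q : R * R => (clamp (fst q), clamp (2 * snd q - 1))) (fun q => K (fst q) (snd q))); auto; cont.
- intros s t Hs Ht; destruct (Rle_dec t (1/2)); [rewrite E1|rewrite E2]; auto; lra.
- intros s Hs; rewrite E1, (clamp_le (2 * 0)); auto; lra.
- intros s Hs; rewrite E2, (clamp_ge (2 * 1 - 1)); auto; lra.
- intros t [Ht Ht'];  destruct (Rle_dec t (1/2)).
  + rewrite E1, (path_concat_first a b), (clamp_id 0), clamp_id, Hg; auto; unfold unit_interval; lra.
  + rewrite E2, (path_concat_second a b), (clamp_id 0), clamp_id, Kh; auto; unfold unit_interval; lra.
- intros t [Ht Ht']; destruct (Rle_dec t (1/2)).
  + rewrite E1, (path_concat_first a b), (clamp_id 1), clamp_id, Hg'; auto; unfold unit_interval; lra.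
  + rewrite E2, (path_concat_second a b), (clamp_id 1), clamp_id, Kh'; auto; unfold unit_interval; lra.
Qed.

Lemma path_homotopic_path_inv a b g g' :
  path_homotopic X a b g g' -> path_homotopic X b a (path_inv g) (path_inv g').
Proof.
intros HH; destruct (path_homotopic_elim _ _ _ _ HH) as (H & HC & HX & Ha & Hb & Hg & Hg').
apply path_homotopic_intro with (fun s t => H s (1 - t)); auto.
- intros; apply (continuous_comp (fun q : R * R => (fst q, 1 - snd q)) (fun q => H (fst q) (snd q))); auto; cont.
- intros; replace (1 - 0) with 1 by lra; auto.
- intros; replace (1 - 1) with 0 by lra; auto.
- intros t Ht; apply Hg; unfold unit_interval in *; lra.
- intros t Ht; apply Hg'; unfold unit_interval in *; lra.
Qed.

Lemma is_path_concat a b c g h :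
  is_path X a b g -> is_path X b c h -> is_path X a c (path_concat g h).
Proof.
intros Hg Hh; apply (path_homotopic_is_path a c (path_concat g h) (path_concat g h)).
apply path_homotopic_concat with b; now apply path_homotopic_refl.
Qed.

Lemma is_path_inv a b g : is_path X a b g -> is_path X b a (path_inv g).
Proof.
intros Hg; apply (path_homotopic_is_path b a (path_inv g) (path_inv g)).
now apply path_homotopic_path_inv, path_homotopic_refl.
Qed.

Lemma is_path_const a : X a -> is_path X a a (fun _ => a).
Proof. intros; apply is_path_intro; auto; cont. Qed.

End Paths.

Definition convex (W : C -> Prop) : Prop :=
  forall z w s, W z -> W w -> unit_interval s -> W (RtoC (1 - s) * z + RtoC s * w)%C.

(** The straight-line homotopy, pushed forward along [f]: reparametrizations,
    triangles, arcs and twists all reduce to it for suitable [W] and [f]. *)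
Lemma path_homotopic_convex (W X : C -> Prop) (f : C -> C) z w g h :
  convex W -> (forall p, continuous f p) -> (forall p, W p -> X (f p)) ->
  is_path W z w g -> is_path W z w h ->
  path_homotopic X (f z) (f w) (fun t => f (g t)) (fun t => f (h t)).
Proof.
intros HW Hf HX Hg Hh; pose proof (is_path_clamp _ _ _ _ Hg); pose proof (is_path_clamp _ _ _ _ Hh).
destruct Hg as (_ & Wg & Hg0 & Hg1), Hh as (_ & Wh & Hh0 & Hh1).
apply path_homotopic_intro with
  (fun s t => f (RtoC (1 - s) * g (clamp t) + RtoC s * h (clamp t))%C).
- intros q; apply (continuous_comp (fun q : R * R =>
    (RtoC (1 - fst q) * g (clamp (snd q)) + RtoC (fst q) * h (clamp (snd q)))%C) f); auto.
  cont; [apply (continuous_comp (fun q : R * R => snd q) (fun t => g (clamp t)))|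
         apply (continuous_comp (fun q : R * R => snd q) (fun t => h (clamp t)))]; auto; cont.
- intros; apply HX, HW; auto.
- intros; rewrite clamp_id, Hg0, Hh0, RtoC_minus by auto; f_equal; ring.
- intros; rewrite clamp_id, Hg1, Hh1, RtoC_minus by auto; f_equal; ring.
- intros; rewrite clamp_id, Rminus_0_r by auto; f_equal; ring.
- intros; rewrite clamp_id, Rminus_diag by auto; f_equal; ring.
Qed.

Lemma convex_strip a b : convex (fun z => a <= fst z <= b).
Proof.
intros z w s Hz Hw [H0 H1]; simpl.
split; [apply Rle_trans with ((1 - s) * a + s * a)|apply Rle_trans with ((1 - s) * b + s * b)]; nra.
Qed.

Lemma path_concat_map (f : C -> C) g h t :
  f (path_concat g h t) = path_concat (fun t => f (g t)) (fun t => f (h t)) t.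
Proof. unfold path_concat; now destruct Rle_dec. Qed.

Lemma path_concat_ext g g' h h' t : (forall t, unit_interval t -> g t = g' t) ->
  (forall t, unit_interval t -> h t = h' t) -> unit_interval t ->
  path_concat g h t = path_concat g' h' t.
Proof.
intros Hg Hh [H0 H1]; unfold path_concat; destruct Rle_dec; [apply Hg|apply Hh];
  unfold unit_interval; lra.
Qed.

Lemma is_path_line (W : C -> Prop) a b : (forall t, unit_interval t -> W (RtoC (a + t * (b - a)))) ->
  is_path W (RtoC a) (RtoC b) (fun t => RtoC (a + t * (b - a))).
Proof. intros H; apply is_path_intro; auto; [cont| |]; f_equal; ring. Qed.

(** * Groupoid laws up to homotopy *)

Section Laws.
Variable X : C -> Prop.

Lemma path_homotopic_cast a b g g' h h' : path_homotopic X a b g h ->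
  (forall t, unit_interval t -> g t = g' t) -> (forall t, unit_interval t -> h t = h' t) ->
  path_homotopic X a b g' h'.
Proof.
intros (H & HC & HP & Hg & Hh) E1 E2; exists H; repeat split; auto; try apply HP; auto; intros.
- rewrite <- E1; auto.
- rewrite <- E2; auto.
Qed.

(** Both bracketings are images, under one map, of paths from 0 to 3 in the strip of real parts
    between 0 and 3, and a strip is convex. *)
Lemma path_homotopic_assoc a b c d g h k :
  is_path X a b g -> is_path X b c h -> is_path X c d k ->
  path_homotopic X a d (path_concat (path_concat g h) k) (path_concat g (path_concat h k)).
Proof.
intros Hg Hh Hk.
pose proof (is_path_clamp _ _ _ _ Hg) as Cg; pose proof (is_path_clamp _ _ _ _ Hh) as Ch;
  pose proof (is_path_clamp _ _ _ _ Hk) as Ck.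
(* Lays [g], [h], [k] end to end over [0,1], [1,2], [2,3]; subtracting [b] and [c] cancels the paths
   that are frozen at an endpoint. *)
set (f := fun z : C => (g (clamp (fst z)) + (h (clamp (fst z - 1)) - b) + (k (clamp (fst z - 2)) - c))%C).
destruct Hg as (_ & Xg & Hg0 & Hg1), Hh as (_ & Xh & Hh0 & Hh1), Hk as (_ & Xk & Hk0 & Hk1).
assert (E0 : forall s, s <= 1 -> f (RtoC s) = g (clamp s)).
{ intros s Hs; unfold f; simpl; rewrite (clamp_le (s - 1)), (clamp_le (s - 2)), Hh0, Hk0 by lra; ring. }
assert (E1 : forall s, 1 <= s <= 2 -> f (RtoC s) = h (clamp (s - 1))).
{ intros s Hs; unfold f; simpl; rewrite (clamp_ge s), (clamp_le (s - 2)), Hg1, Hk0 by lra; ring. }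
assert (E2 : forall s, 2 <= s -> f (RtoC s) = k (clamp (s - 2))).
{ intros s Hs; unfold f; simpl; rewrite (clamp_ge s), (clamp_ge (s - 1)), Hg1, Hh1 by lra; ring. }
set (i := fun a t => RtoC (a + t * ((a + 1) - a))).
set (W := fun z : C => 0 <= fst z <= 3).
assert (P0 : is_path W (RtoC 0) (RtoC 1) (i 0)).
{ replace 1 with (0 + 1) by lra; apply is_path_line; unfold W; simpl; intros t [? ?]; lra. }
assert (P1 : is_path W (RtoC 1) (RtoC 2) (i 1)).
{ replace 2 with (1 + 1) by lra; apply is_path_line; unfold W; simpl; intros t [? ?]; lra. }
assert (P2 : is_path W (RtoC 2) (RtoC 3) (i 2)).
{ replace 3 with (2 + 1) by lra; apply is_path_line; unfold W; simpl; intros t [? ?]; lra. }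
assert (Ea : f (RtoC 0) = a) by (rewrite E0, clamp_id; auto; lra).
assert (Ed : f (RtoC 3) = d).
{ rewrite E2 by lra; replace (3 - 2) with 1 by lra; rewrite clamp_id; auto. }
assert (F0 : forall t, unit_interval t -> f (i 0 t) = g t).
{ intros t [? ?]; unfold i; rewrite E0 by lra; f_equal; rewrite clamp_id; unfold unit_interval; lra. }
assert (F1 : forall t, unit_interval t -> f (i 1 t) = h t).
{ intros t [? ?]; unfold i; rewrite E1 by lra; f_equal; rewrite clamp_id; unfold unit_interval; lra. }
assert (F2 : forall t, unit_interval t -> f (i 2 t) = k t).
{ intros t [? ?]; unfold i; rewrite E2 by lra; f_equal; rewrite clamp_id; unfold unit_interval; lra. }
rewrite <- Ea, <- Ed.
apply (path_homotopic_cast _ _ (fun t => f (path_concat (path_concat (i 0) (i 1)) (i 2) t)) _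
         (fun t => f (path_concat (i 0) (path_concat (i 1) (i 2)) t))).
- apply (path_homotopic_convex W).
  + apply convex_strip.
  + intros p; unfold f; cont;
     [apply (continuous_comp (fun q : C => fst q) (fun t => g (clamp t)))
     |apply (continuous_comp (fun q : C => fst q - 1) (fun t => h (clamp t)))
     |apply (continuous_comp (fun q : C => fst q - 2) (fun t => k (clamp t)))]; auto; cont.
  + intros [s y] Hs; unfold W in Hs; simpl in Hs.
    replace (f (s, y)) with (f (RtoC s)) by reflexivity.
    destruct (Rle_dec s 1); [rewrite E0|destruct (Rle_dec s 2); [rewrite E1|rewrite E2]]; auto; lra.
  + apply is_path_concat with (RtoC 2); auto; apply is_path_concat with (RtoC 1); auto.
  + apply is_path_concat with (RtoC 1); auto; apply is_path_concat with (RtoC 2); auto.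
- intros t Ht; rewrite path_concat_map; apply path_concat_ext; auto.
  intros u Hu; rewrite path_concat_map; apply path_concat_ext; auto.
- intros t Ht; rewrite path_concat_map; apply path_concat_ext; auto.
  intros u Hu; rewrite path_concat_map; apply path_concat_ext; auto.
Qed.

(** The groupoid laws involving inverses and constants are images under [g] of
    homotopies in [0,1]. *)
Lemma path_homotopic_param a b g x y z l m : is_path X a b g ->
  unit_interval x -> unit_interval y -> unit_interval z ->
  (forall t, unit_interval t -> l t = g (x + t * (y - x))) ->
  (forall t, unit_interval t -> m t = g (y + t * (z - y))) ->
  path_homotopic X (g x) (g z) (path_concat l m) (fun t => g (x + t * (z - x))).
Proof.
intros Hg Hx Hy Hz Hl Hm; pose proof (is_path_clamp _ _ _ _ Hg) as Cg.
set (f := fun z : C => g (clamp (fst z))).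
assert (Ix : forall x y t, unit_interval x -> unit_interval y -> unit_interval t ->
  unit_interval (x + t * (y - x))) by (unfold unit_interval; intros; nra).
assert (E : forall t, unit_interval t -> f (RtoC t) = g t).
{ intros t Ht; unfold f; simpl; rewrite clamp_id; auto. }
rewrite <- (E x), <- (E z) by auto.
apply (path_homotopic_cast _ _
  (fun t => f (path_concat (fun t => RtoC (x + t * (y - x))) (fun t => RtoC (y + t * (z - y))) t)) _
  (fun t => f (RtoC (x + t * (z - x))))).
- apply (path_homotopic_convex (fun z => 0 <= fst z <= 1)).
  + apply convex_strip.
  + intros p; apply (continuous_comp (fun q : C => fst q) (fun t => g (clamp t))); auto; cont.
  + intros p Hp; apply Hg; auto.
  + apply is_path_concat with (RtoC y); apply is_path_line; simpl; intros; apply Ix; auto.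
  + apply is_path_line; simpl; intros; apply Ix; auto.
- intros t Ht; rewrite path_concat_map; apply path_concat_ext; auto; intros; rewrite E; auto;
  symmetry; auto.
- intros t Ht; rewrite E; auto.
Qed.

Lemma path_homotopic_id_r a b g : is_path X a b g ->
  path_homotopic X a b (path_concat g (fun _ => b)) g.
Proof.
intros Hg; pose proof Hg as (_ & _ & H0 & H1); rewrite <- H0, <- H1 at 1.
apply path_homotopic_cast with (path_concat g (fun _ => b)) (fun t => g (0 + t * (1 - 0))).
- apply path_homotopic_param with a b 1; auto; intros; [f_equal; ring|].
  rewrite <- H1; f_equal; ring.
- auto.
- intros; f_equal; ring.
Qed.

Lemma path_homotopic_id_l a b g : is_path X a b g ->
  path_homotopic X a b (path_concat (fun _ => a) g) g.
Proof.
intros Hg; pose proof Hg as (_ & _ & H0 & H1); rewrite <- H0, <- H1 at 1.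
apply path_homotopic_cast with (path_concat (fun _ => a) g) (fun t => g (0 + t * (1 - 0))).
- apply path_homotopic_param with a b 0; auto; intros; [|f_equal; ring].
  rewrite <- H0; f_equal; ring.
- auto.
- intros; f_equal; ring.
Qed.

Lemma path_homotopic_inv_r a b g : is_path X a b g ->
  path_homotopic X a a (path_concat g (path_inv g)) (fun _ => a).
Proof.
intros Hg; pose proof Hg as (_ & _ & H0 & H1); rewrite <- H0 at 1 2.
apply path_homotopic_cast with (path_concat g (path_inv g)) (fun t => g (0 + t * (0 - 0))).
- apply path_homotopic_param with a b 1; auto; intros; [|unfold path_inv]; f_equal; ring.
- auto.
- intros; rewrite <- H0; f_equal; ring.
Qed.

Lemma path_inv_involutive g t : path_inv (path_inv g) t = g t.
Proof. unfold path_inv; f_equal; ring. Qed.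

Lemma path_homotopic_inv_l a b g : is_path X a b g ->
  path_homotopic X b b (path_concat (path_inv g) g) (fun _ => b).
Proof.
intros Hg; apply is_path_inv in Hg.
apply path_homotopic_cast with (1 := path_homotopic_inv_r _ _ _ Hg); auto.
intros; apply path_concat_ext; auto; intros; apply path_inv_involutive.
Qed.

End Laws.

(** Paths bundled with their endpoints, so that homotopy classes form a
    groupoid in which one can rewrite. *)
Record path (X : C -> Prop) (a b : C) := Path { pfun : R -> C; pfun_path : is_path X a b pfun }.
Arguments Path {X a b} _ _.
Arguments pfun {X a b} _.
Arguments pfun_path {X a b} _.

Definition peq {X a b} (p q : path X a b) : Prop := path_homotopic X a b (pfun p) (pfun q).
Definition pcat {X a b c} (p : path X a b) (q : path X b c) : path X a c :=
  Path _ (is_path_concat _ _ _ _ _ _ (pfun_path p) (pfun_path q)).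
Definition pinv {X a b} (p : path X a b) : path X b a :=
  Path _ (is_path_inv _ _ _ _ (pfun_path p)).

Declare Scope path_scope.
Delimit Scope path_scope with path.
Local Infix "==" := peq (at level 70) : path_scope.
Local Infix "*" := pcat : path_scope.
Local Notation "p ^-1" := (pinv p) (at level 9, format "p ^-1") : path_scope.

#[local] Instance peq_equivalence X a b : Equivalence (@peq X a b).
Proof.
split.
- intros p; apply path_homotopic_refl, pfun_path.
- intros p q; apply path_homotopic_sym.
- intros p q r; apply path_homotopic_trans.
Qed.

#[local] Instance pcat_proper X a b c : Proper (peq ==> peq ==> peq) (@pcat X a b c).
Proof. intros p p' Hp q q' Hq; exact (path_homotopic_concat _ _ _ _ _ _ _ _ Hp Hq). Qed.

#[local] Instance pinv_proper X a b : Proper (peq ==> peq) (@pinv X a b).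
Proof. intros p p' Hp; exact (path_homotopic_path_inv _ _ _ _ _ Hp). Qed.

Section Groupoid.
Local Open Scope path_scope.
Variable X : C -> Prop.
Implicit Types a b c d : C.

Definition pid a (Xa : X a) : path X a a := Path _ (is_path_const X a Xa).

Lemma pcatA a b c d (p : path X a b) (q : path X b c) (r : path X c d) :
  p * q * r == p * (q * r).
Proof. apply (path_homotopic_assoc X a b c d); apply pfun_path. Qed.

Lemma path_start a b (p : path X a b) : X a.
Proof. destruct p as [p (_ & Xp & H0 & _)]; simpl in *; rewrite <- H0; auto. Qed.

Lemma path_end a b (p : path X a b) : X b.
Proof. destruct p as [p (_ & Xp & _ & H1)]; simpl in *; rewrite <- H1; auto. Qed.

Lemma pcat1p a b Xa (p : path X a b) : pid a Xa * p == p.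
Proof. apply path_homotopic_id_l, pfun_path. Qed.

Lemma pcatp1 a b Xb (p : path X a b) : p * pid b Xb == p.
Proof. apply path_homotopic_id_r, pfun_path. Qed.

Lemma pcatpV a b Xa (p : path X a b) : p * p^-1 == pid a Xa.
Proof. apply (path_homotopic_inv_r X a b), pfun_path. Qed.

Lemma pcatVp a b Xb (p : path X a b) : p^-1 * p == pid b Xb.
Proof. apply (path_homotopic_inv_l X a b), pfun_path. Qed.

Lemma pcatVK a b c (p : path X a b) (q : path X b c) : p^-1 * (p * q) == q.
Proof. rewrite <- pcatA, (pcatVp _ _ (path_start _ _ q)); apply pcat1p. Qed.

Lemma pcatKV a b c (p : path X b a) (q : path X b c) : p * (p^-1 * q) == q.
Proof. rewrite <- pcatA, (pcatpV _ _ (path_start _ _ q)); apply pcat1p. Qed.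

Lemma pinvK a b (p : path X a b) : p^-1^-1 == p.
Proof.
apply path_homotopic_ext; [apply pfun_path|]; intros; apply path_inv_involutive.
Qed.

Lemma pcat_injl a b c (p : path X a b) (q r : path X b c) : p * q == p * r -> q == r.
Proof. intros H; rewrite <- (pcatVK _ _ _ p q), H; apply pcatVK. Qed.

Lemma pinvM a b c (p : path X a b) (q : path X b c) : (p * q)^-1 == q^-1 * p^-1.
Proof.
apply (pcat_injl _ _ _ (p * q)).
rewrite (pcatpV _ _ (path_start _ _ p)), pcatA, pcatKV.
now rewrite (pcatpV _ _ (path_start _ _ p)).
Qed.

End Groupoid.

(** * Normal closures *)

Section NormalClosure.
Local Open Scope path_scope.
Variables (X : C -> Prop) (u : C) (P : (R -> C) -> Prop).
Hypothesis Xu : X u.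
Implicit Types p q r x e : path X u u.

(** Equality in the quotient of pi_1(X, u) by the normal closure of [P]. *)
Definition neq p q : Prop := normal_closure X u P (relator (pfun p) (pfun q)).
Local Infix "~~" := neq (at level 70).

Lemma nc_peq p q : p == q -> normal_closure X u P (pfun p) -> normal_closure X u P (pfun q).
Proof. intros H Hp; exact (nc_class _ _ _ _ _ Hp H). Qed.

Lemma neq_of_peq p q : p == q -> p ~~ q.
Proof.
intros H; apply (nc_peq (pid X u Xu) (p * q^-1)); [|exact (nc_one X u P)].
rewrite H; symmetry; apply pcatpV.
Qed.

#[local] Instance neq_equivalence : Equivalence neq.
Proof.
split.
- intros p; now apply neq_of_peq.
- intros p q H; apply (nc_peq (p * q^-1)^-1 (q * p^-1)); [|now apply nc_inv].
  now rewrite pinvM, pinvK.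
- intros p q r H K; apply (nc_peq (p * q^-1 * (q * r^-1)) (p * r^-1)); [|now apply nc_mul].
  now rewrite pcatA, pcatVK.
Qed.

#[local] Instance peq_neq_subrelation : subrelation peq neq.
Proof. exact neq_of_peq. Qed.

(** Normality enters here: (p q)(p' q')^-1 is the conjugate by [p] of q q'^-1, times p p'^-1. *)
#[local] Instance pcat_neq_proper : Proper (neq ==> neq ==> neq) (@pcat X u u u).
Proof.
intros p p' Hp q q' Hq.
apply (nc_peq (p * (q * q'^-1) * p^-1 * (p * p'^-1)) ((p * q) * (p' * q')^-1)).
- now rewrite pinvM, !pcatA, pcatVK.
- apply nc_mul; [apply (nc_conj _ _ _ (pfun p) (pfun (q * q'^-1))); auto; apply (pfun_path p)|exact Hp].
Qed.

Lemma neq_injl p q r : p * q ~~ p * r -> q ~~ r.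
Proof. intros H; rewrite <- (pcatVK _ _ _ _ p q), H; now rewrite pcatVK. Qed.

Lemma neq_injr p q r : q * p ~~ r * p -> q ~~ r.
Proof.
intros H; rewrite <- (pcatp1 _ _ _ Xu q), <- (pcatp1 _ _ _ Xu r), <- (pcatpV _ _ _ Xu p).
now rewrite <- !pcatA, H.
Qed.

Lemma neq_conj e x : e * x * e^-1 ~~ x <-> e * x ~~ x * e.
Proof.
split; intros H.
- rewrite <- H at 2; now rewrite !pcatA, (pcatVp _ _ _ Xu), pcatp1.
- rewrite H, pcatA, (pcatpV _ _ _ Xu), pcatp1; reflexivity.
Qed.

Section Relations.
Variables x1 x2 x3 : path X u u.
Let s := x2 * x1.
Let d := x3 * s.
Let e := d * s.

(** The commutation of [d] with [x3] gives the first relation after cancelling a leading [x3]; that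
    of [e] with [x1] gives the second after cancelling the last letter [x1], common to both
    sides. *)
Lemma stated_of_induced :
  d * x3 * d^-1 ~~ x3 -> e * x1 * e^-1 ~~ x1 ->
  x3 * x2 * x1 ~~ x2 * x1 * x3 /\
  x3 * x2 * x1 * x2 * x1 ~~ x1 * x3 * x2 * x1 * x2.
Proof.
unfold e, d, s; rewrite !neq_conj; intros H3 H1; split.
- apply (neq_injl x3); rewrite pcatA, <- H3, !pcatA; reflexivity.
- apply (neq_injr x1); repeat rewrite pcatA in H1; repeat rewrite pcatA; exact H1.
Qed.

(** By the first relation e = x3 s s commutes with s = x2 x1, by the second with [x1]; hence it
    commutes with [x2] = s x1^-1. *)
Lemma induced_of_stated :
  x3 * x2 * x1 ~~ x2 * x1 * x3 ->
  x3 * x2 * x1 * x2 * x1 ~~ x1 * x3 * x2 * x1 * x2 ->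
  d * x3 * d^-1 ~~ x3 /\ e * x1 * e^-1 ~~ x1 /\ e * x2 * e^-1 ~~ x2.
Proof.
intros H3 H1; rewrite !neq_conj.
assert (Hs : x3 * s ~~ s * x3) by (unfold s; rewrite <- pcatA; exact H3).
assert (He1 : e * x1 ~~ x1 * e).
{ unfold e, d, s; repeat rewrite pcatA in H1; repeat rewrite pcatA.
  pose proof (pcat_neq_proper _ _ H1 _ _ (reflexivity x1)) as H2.
  repeat rewrite pcatA in H2; exact H2. }
assert (Hes : e * s ~~ s * e).
{ unfold e, d; rewrite <- (pcatA _ _ _ _ _ s (x3 * s) s), <- (pcatA _ _ _ _ _ s x3 s), <- Hs; reflexivity. }
split; [|split]; auto.
- unfold d; rewrite pcatA, <- Hs; reflexivity.
(* Multiplied on the right by [x1], the claim e x2 = x2 e becomes e s = s e, because [e] may be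
   moved across [x1]. *)
- apply (neq_injr x1); rewrite (pcatA _ _ _ _ _ x2 e x1), He1, pcatA.
  rewrite <- (pcatA _ _ _ _ _ x2 x1 e); exact Hes.
Qed.
End Relations.

End NormalClosure.

Lemma normal_closure_sub X u (P Q : (R -> C) -> Prop) g :
  (forall g, is_loop X u g -> P g -> normal_closure X u Q g) ->
  normal_closure X u P g -> normal_closure X u Q g.
Proof.
intros H; induction 1 as [g Hg Pg| |g h _ Hg _ Hh|g _ Hg|c g Hc _ Hg|g h _ Hg E].
- auto.
- apply nc_one.
- now apply nc_mul.
- now apply nc_inv.
- now apply nc_conj.
- now apply nc_class with g.
Qed.

(** * Radial twists *)

(** The functions denoted by these expressions are closed under partial
    derivatives, hence infinitely differentiable. *)
Inductive fexpr : Set :=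
| Fcst (c : R) | Fx | Fy | Fadd (e f : fexpr) | Fmul (e f : fexpr)
| Fcos (e : fexpr) | Fsin (e : fexpr).

Fixpoint feval (e : fexpr) (x y : R) : R :=
  match e with
  | Fcst c => c | Fx => x | Fy => y
  | Fadd e f => feval e x y + feval f x y
  | Fmul e f => feval e x y * feval f x y
  | Fcos e => cos (feval e x y)
  | Fsin e => sin (feval e x y)
  end.

Fixpoint fdiff (dx dy : R) (e : fexpr) : fexpr :=
  match e with
  | Fcst _ => Fcst 0 | Fx => Fcst dx | Fy => Fcst dy
  | Fadd e f => Fadd (fdiff dx dy e) (fdiff dx dy f)
  | Fmul e f => Fadd (Fmul (fdiff dx dy e) f) (Fmul e (fdiff dx dy f))
  | Fcos e => Fmul (fdiff dx dy e) (Fmul (Fcst (-1)) (Fsin e))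
  | Fsin e => Fmul (fdiff dx dy e) (Fcos e)
  end.

Lemma is_derive_feval_x e x y :
  is_derive (fun z => feval e z y) x (feval (fdiff 1 0 e) x y).
Proof.
induction e as [c| | |e He f Hf|e He f Hf|e He|e He]; simpl.
- exact (is_derive_const c x).
- exact (is_derive_id x).
- exact (is_derive_const y x).
- exact (is_derive_plus _ _ _ _ _ He Hf).
- apply (is_derive_mult _ _ _ _ _ He Hf); intros; apply Rmult_comm.
- replace (-1 * _) with (- sin (feval e x y)) by ring.
  exact (is_derive_comp cos _ _ _ _ (is_derive_cos _) He).
- exact (is_derive_comp sin _ _ _ _ (is_derive_sin _) He).
Qed.

Lemma is_derive_feval_y e x y :
  is_derive (fun z => feval e x z) y (feval (fdiff 0 1 e) x y).
Proof.
induction e as [c| | |e He f Hf|e He f Hf|e He|e He]; simpl.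
- exact (is_derive_const c y).
- exact (is_derive_const x y).
- exact (is_derive_id y).
- exact (is_derive_plus _ _ _ _ _ He Hf).
- apply (is_derive_mult _ _ _ _ _ He Hf); intros; apply Rmult_comm.
- replace (-1 * _) with (- sin (feval e x y)) by ring.
  exact (is_derive_comp cos _ _ _ _ (is_derive_cos _) He).
- exact (is_derive_comp sin _ _ _ _ (is_derive_sin _) He).
Qed.

Lemma continuity_2d_feval e x y : continuity_2d_pt (feval e) x y.
Proof.
induction e as [c| | |e He f Hf|e He f Hf|e He|e He]; simpl.
- apply continuity_2d_pt_const.
- apply continuity_2d_pt_id1.
- apply continuity_2d_pt_id2.
- now apply continuity_2d_pt_plus.
- now apply continuity_2d_pt_mult.
- apply (continuity_1d_2d_pt_comp cos); auto; apply continuity_cos.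
- apply (continuity_1d_2d_pt_comp sin); auto; apply continuity_sin.
Qed.

Lemma ex_diff_n_feval n e x y : ex_diff_n (feval e) n x y.
Proof.
revert e; induction n as [|n IH]; intros e; (split; [apply continuity_2d_feval|]); auto.
split; [eexists; apply is_derive_feval_x|split; [eexists; apply is_derive_feval_y|split]].
- apply ex_diff_n_ext_loc with (feval (fdiff 1 0 e)); auto.
  apply locally_2d_forall; intros u v; symmetry; apply is_derive_unique, is_derive_feval_x.
- apply ex_diff_n_ext_loc with (feval (fdiff 0 1 e)); auto.
  apply locally_2d_forall; intros u v; symmetry; apply is_derive_unique, is_derive_feval_y.
Qed.

(** Replaces [Cmod] throughout: without the square root, bounds on radii are polynomial
    inequalities. *)
Definition sqnorm (z : C) : R := fst z * fst z + snd z * snd z.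

Lemma Cmod_le_sqnorm z r : 0 <= r -> (Cmod z <= r <-> sqnorm z <= r * r).
Proof.
intros Hr; unfold Cmod, sqnorm; split; intros H.
- rewrite <- (sqrt_square r) in H by auto; apply sqrt_le_0 in H; nra.
- rewrite <- (sqrt_square r) by auto; apply sqrt_le_1_alt; nra.
Qed.

Lemma Cmod_eq_sqnorm z : Cmod z * Cmod z = sqnorm z.
Proof. unfold Cmod, sqnorm; rewrite sqrt_sqrt; nra. Qed.

Lemma D_sqnorm z : D z <-> sqnorm z <= 16.
Proof. unfold D; rewrite Cmod_le_sqnorm by lra; lra. Qed.

Lemma sqnorm_mult z w : sqnorm (z * w) = sqnorm z * sqnorm w.
Proof. unfold sqnorm; simpl; ring. Qed.

Lemma sqnorm_cis t : sqnorm (cis t) = 1.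
Proof. unfold sqnorm, cis; simpl; pose proof (sin2_cos2 t); unfold Rsqr in *; lra. Qed.

Lemma cis_add s t : cis (s + t) = (cis s * cis t)%C.
Proof. unfold cis, Cmult; simpl; rewrite cos_plus, sin_plus; f_equal; ring. Qed.

Lemma cis_0 : cis 0 = RtoC 1.
Proof. unfold cis; rewrite cos_0, sin_0; reflexivity. Qed.

Lemma cis_nat n : cis (2 * PI * INR n) = RtoC 1.
Proof.
induction n as [|n IH]; [simpl; rewrite Rmult_0_r; apply cis_0|].
rewrite S_INR, Rmult_plus_distr_l, cis_add, IH, Rmult_1_r.
unfold cis; rewrite cos_2PI, sin_2PI; unfold Cmult, RtoC; simpl; f_equal; ring.
Qed.

(** The angle is a function of the squared radius, so that a polynomial angle gives a map smooth at
    0 too. As the radius is preserved, composing twists adds their angles. *)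
Definition twist (psi : R -> R) (z : C) : C := (z * cis (psi (sqnorm z)))%C.

Lemma sqnorm_twist psi z : sqnorm (twist psi z) = sqnorm z.
Proof. unfold twist; rewrite sqnorm_mult, sqnorm_cis; ring. Qed.

Lemma D_twist psi z : D z -> D (twist psi z).
Proof. rewrite !D_sqnorm, sqnorm_twist; auto. Qed.

Lemma twist_twist psi psi' z : twist psi (twist psi' z) = twist (fun w => psi' w + psi w) z.
Proof. unfold twist at 1; rewrite sqnorm_twist; unfold twist; rewrite cis_add; ring. Qed.

Lemma twist_id psi z : psi (sqnorm z) = 0 -> twist psi z = z.
Proof. intros H; unfold twist; rewrite H, cis_0; ring. Qed.

(** [angle a b] interpolates the angles [a] on the unit circle, [b] on the
    circle of radius 2 and 0 on the boundary of [D]; being polynomial in the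
    squared radius, it makes [twist (angle a b)] smooth on the whole plane. *)
Definition angle (a b w : R) : R :=
  a * ((w - 4) * (w - 16) / 45) + b * (- ((w - 1) * (w - 16) / 36)).

Lemma angle_1 a b : angle a b 1 = a.
Proof. unfold angle; field. Qed.
Lemma angle_4 a b : angle a b 4 = b.
Proof. unfold angle; field. Qed.
Lemma angle_16 a b : angle a b 16 = 0.
Proof. unfold angle; field. Qed.

Lemma angle_opp a b w : angle (- a) (- b) w = - angle a b w.
Proof. unfold angle; ring. Qed.

Lemma twist_angle_opp a b z : twist (angle (- a) (- b)) (twist (angle a b) z) = z.
Proof. rewrite twist_twist; apply twist_id; rewrite angle_opp; ring. Qed.

Lemma twist_angle_opp' a b z : twist (angle a b) (twist (angle (- a) (- b)) z) = z.
Proof. rewrite twist_twist; apply twist_id; rewrite angle_opp; ring. Qed.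

Lemma smooth_twist_angle a b A : smooth_on A (twist (angle a b)).
Proof.
exists (fun _ => True), (twist (angle a b)); split; [apply open_true|]; split; auto; split; auto.
(* [W k] is the squared radius minus [k], and [T] is [angle a b] at the squared radius; the two
   goals are the real and the imaginary part of the twist. *)
set (W k := Fadd (Fadd (Fmul Fx Fx) (Fmul Fy Fy)) (Fcst (- k))).
set (T := Fadd (Fmul (Fcst a) (Fmul (Fmul (W 4) (W 16)) (Fcst (/ 45))))
  (Fmul (Fcst b) (Fmul (Fmul (Fmul (W 1) (W 16)) (Fcst (/ 36))) (Fcst (-1))))).
assert (E : forall x y, angle a b (sqnorm (x, y)) = feval T x y).
{ intros x y; unfold angle, sqnorm; simpl; field. }
intros z n _; split.
- apply ex_diff_n_ext_loc with
    (feval (Fadd (Fmul Fx (Fcos T)) (Fmul (Fcst (-1)) (Fmul Fy (Fsin T))))).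
  + apply locally_2d_forall; intros x y; unfold twist, cis; rewrite E; simpl feval; simpl fst; simpl snd; ring.
  + apply ex_diff_n_feval.
- apply ex_diff_n_ext_loc with (feval (Fadd (Fmul Fx (Fsin T)) (Fmul Fy (Fcos T)))).
  + apply locally_2d_forall; intros x y; unfold twist, cis; rewrite E; simpl feval; simpl fst; simpl snd; ring.
  + apply ex_diff_n_feval.
Qed.

Lemma twist_angle_diffeo a b : is_diffeo_rel_boundary (twist (angle a b)).
Proof.
split; [split; [|split]|].
- apply D_twist.
- apply smooth_twist_angle.
- exists (twist (angle (- a) (- b))); repeat split; intros.
  + now apply D_twist.
  + apply smooth_twist_angle.
  + apply twist_angle_opp.
  + apply twist_angle_opp'.
- intros z Hz; apply twist_id.
  replace (sqnorm z) with 16; [apply angle_16|].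
  rewrite <- Cmod_eq_sqnorm, Hz; ring.
Qed.

Lemma cont_sqnorm {T : UniformSpace} (f : T -> C) x :
  continuous f x -> continuous (fun y => sqnorm (f y)) x.
Proof. intros H; unfold sqnorm; cont. Qed.

Lemma cont_twist_angle {T : UniformSpace} (a b : T -> R) (f : T -> C) x :
  continuous a x -> continuous b x -> continuous f x ->
  continuous (fun y => twist (angle (a y) (b y)) (f y)) x.
Proof.
intros Ha Hb Hf; unfold twist, angle, Rdiv; pose proof (cont_sqnorm f x Hf) as Hs; cont.
Qed.

(** * The fibres of the curve *)

Lemma Cmult_eq_0 (a b : C) : (a * b)%C = RtoC 0 -> a = RtoC 0 \/ b = RtoC 0.
Proof.
intros H; assert (H' : Cmod a * Cmod b = 0) by (rewrite <- Cmod_mult, H; apply Cmod_0).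
apply Rmult_integral in H' as [H'|H']; [left|right]; now apply Cmod_eq_0.
Qed.

Lemma fibre_spec x y : E x ->
  (fibre S_curve x y <-> y = (- (x * x))%C \/ y = (x * x)%C \/ y = (RtoC 2 * x)%C).
Proof.
assert (S : forall a b : C, (a - b)%C = RtoC 0 -> a = b).
{ intros a b H; replace a with (a - b + b)%C by ring; rewrite H; ring. }
intros Hx; assert (Hx' : Cmod (x * x) <= 1).
{ rewrite Cmod_mult; pose proof (Cmod_ge_0 x); unfold E in Hx; nra. }
unfold fibre, S_curve; split.
- intros (_ & _ & H); apply Cmult_eq_0 in H as [H|H]; [apply Cmult_eq_0 in H as [H|H]|].
  + right; right; symmetry; now apply S.
  + left; apply S; rewrite <- H; ring.
  + right; left; now apply S.
- intros H; split; auto; split; unfold D.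
  + destruct H as [->|[->| ->]]; rewrite ?Cmod_opp; try lra.
    rewrite Cmod_mult, Cmod_R, Rabs_pos_eq; unfold E in Hx; lra.
  + destruct H as [->|[->| ->]]; ring.
Qed.

Lemma K_fibre_spec z : K_fibre z <-> z = RtoC (-1) \/ z = RtoC 1 \/ z = RtoC 2.
Proof.
unfold K_fibre; rewrite fibre_spec by (unfold E; rewrite Cmod_1; lra).
replace (- (RtoC 1 * RtoC 1))%C with (RtoC (-1)) by (apply injective_projections; simpl; ring).
now rewrite 2!Cmult_1_r.
Qed.

(** * Motions and their braids *)

Lemma K_fibre_sqnorm z : K_fibre z -> sqnorm z = 1 \/ sqnorm z = 4.
Proof. rewrite K_fibre_spec; intros [->|[->| ->]]; unfold sqnorm; simpl; lra. Qed.

Lemma twist_fixes_K psi z : cis (psi 1) = RtoC 1 -> cis (psi 4) = RtoC 1 ->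
  sqnorm z = 1 \/ sqnorm z = 4 -> twist psi z = z.
Proof. intros H1 H4 [H|H]; unfold twist; rewrite H, ?H1, ?H4; ring. Qed.

Lemma K_fibre_twist psi z : cis (psi 1) = RtoC 1 -> cis (psi 4) = RtoC 1 ->
  (K_fibre z <-> K_fibre (twist psi z)).
Proof.
intros H1 H4; split; intros H.
- rewrite twist_fixes_K; auto using K_fibre_sqnorm.
- pose proof (K_fibre_sqnorm _ H) as Hs; rewrite sqnorm_twist in Hs.
  rewrite twist_fixes_K in H; auto.
Qed.

Lemma braid_rep_twist a b : cis a = RtoC 1 -> cis b = RtoC 1 ->
  braid_rep K_fibre (twist (angle a b)).
Proof.
intros Ha Hb; split; [apply twist_angle_diffeo|].
intros z _; apply K_fibre_twist; now rewrite ?angle_1, ?angle_4.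
Qed.

(** Numbered from left to right on the real axis, which agrees with both [twist_motion] and the
    g-base. *)
Definition fibre_point (i : nat) : C :=
  match i with 1%nat => RtoC (-1) | 2%nat => RtoC 1 | _ => RtoC 2 end.

Lemma index_cases i : (1 <= i <= 3)%nat -> i = 1%nat \/ i = 2%nat \/ i = 3%nat.
Proof. lia. Qed.

Lemma fibre_point_spec y : K_fibre y <-> exists i, (1 <= i <= 3)%nat /\ y = fibre_point i.
Proof.
rewrite K_fibre_spec; split.
- intros [H|[H|H]]; [exists 1%nat|exists 2%nat|exists 3%nat]; split; auto; lia.
- intros (i & Hi & ->); destruct (index_cases i Hi) as [->|[->| ->]]; simpl; auto.
Qed.

Lemma fibre_point_inj i j : (1 <= i <= 3)%nat -> (1 <= j <= 3)%nat ->
  fibre_point i = fibre_point j -> i = j.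
Proof.
intros Hi Hj H; destruct (index_cases i Hi) as [->|[->| ->]];
  destruct (index_cases j Hj) as [->|[->| ->]]; auto; apply RtoC_inj in H; lra.
Qed.

Lemma sqnorm_u0 : sqnorm u0 = 16.
Proof. unfold sqnorm, u0; simpl; lra. Qed.

(** * Motions carried by radial twists *)

Section TwistMotion.
Variables (a b : R -> R) (m : nat -> R -> C).
Hypotheses (Ca : forall t, continuous a t) (Cb : forall t, continuous b t).
Hypotheses (a0 : a 0 = 0) (b0 : b 0 = 0) (a1 : cis (a 1) = RtoC 1) (b1 : cis (b 1) = RtoC 1).
Hypothesis Hm : forall i t, (1 <= i <= 3)%nat -> unit_interval t ->
  m i t = twist (angle (a t) (b t)) (fibre_point i).

Lemma twist_motion_start i : (1 <= i <= 3)%nat -> m i 0 = fibre_point i.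
Proof. intros Hi; rewrite Hm, a0, b0 by auto; apply twist_id; unfold angle; ring. Qed.

Lemma is_motion_twist : is_motion 3 K_fibre m.
Proof.
split; [|split; [|split]].
- intros i Hi; split.
  + apply continuous_on_ext with (fun t => twist (angle (a t) (b t)) (fibre_point i)).
    * intros; symmetry; auto.
    * apply continuous_on_forall; intros t _; apply cont_twist_angle; auto; cont.
  + intros t Ht; rewrite Hm by auto; apply D_twist.
    assert (K_fibre (fibre_point i)) as (_ & H & _) by (apply fibre_point_spec; eauto); auto.
- intros i j t Hi Hj Hij Ht; rewrite !Hm by auto; intros H; apply Hij.
  apply fibre_point_inj; auto.
  now rewrite <- (twist_angle_opp (a t) (b t) (fibre_point i)), H, twist_angle_opp.
- intros y; rewrite fibre_point_spec; split; intros (i & Hi & ->); exists i; split; auto;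
    now rewrite twist_motion_start.
- assert (E : forall i, (1 <= i <= 3)%nat -> m i 1 = fibre_point i).
  { intros i Hi; rewrite Hm by auto; apply twist_fixes_K; rewrite ?angle_1, ?angle_4; auto.
    apply K_fibre_sqnorm, fibre_point_spec; eauto. }
  intros y; rewrite fibre_point_spec; split; intros (i & Hi & ->); exists i; split; auto;
    now rewrite E.
Qed.

Lemma realizes_twist : realizes 3 m (fun t => twist (angle (a t) (b t))).
Proof.
split; [|split; [|split]].
- apply continuous_on_forall; intros q _; apply cont_twist_angle; cont.
- intros; apply twist_angle_diffeo.
- intros z _; rewrite a0, b0; apply twist_id; unfold angle; ring.
- intros i t Hi Ht; rewrite twist_motion_start, Hm; auto.
Qed.

(** Two isotopies which move [K] along the same sets end in the same braid:
    follow [Dt] up to time [s], the inverse of the twists back to time 0, and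
    then the full twists. *)
Lemma realizations_homotopic m' Dt g :
  is_motion 3 K_fibre m' -> realizes 3 m' Dt ->
  (forall i t, (1 <= i <= 3)%nat -> unit_interval t ->
     exists j, (1 <= j <= 3)%nat /\ m i t = m' j t) ->
  is_loop (punctured K_fibre) u0 g ->
  homotopic (punctured K_fibre) u0 (act (Dt 1) g) (act (twist (angle (a 1) (b 1))) g).
Proof.
intros (_ & _ & Hm0 & _) (HDt & Hd & Hid & HDm) Hset Hg.
pose proof (is_path_clamp _ _ _ _ Hg) as Cg; destruct Hg as (_ & Xg & g0 & g1).
assert (Fix : forall t, unit_interval t -> Dt t u0 = u0).
{ intros t Ht; apply (proj2 (Hd t Ht)); unfold bdD, Cmod, u0; simpl.
  replace (0 * _ + _) with (4 * 4) by ring; apply sqrt_square; lra. }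
set (Phi := fun s => twist (angle (a 1 - a s) (b 1 - b s))).
assert (Phi0 : forall z, Phi 0 z = twist (angle (a 1) (b 1)) z).
{ intros; unfold Phi; rewrite a0, b0, 2!Rminus_0_r; reflexivity. }
assert (Phi1 : forall z, Phi 1 z = z).
{ intros; apply twist_id; unfold angle; ring. }
(* The homotopy below starts at the full twist, since [Dt 0] is the identity on [D], and ends at
   [Dt 1]; hence the reversal. *)
apply path_homotopic_sym.
apply path_homotopic_intro with (fun s t => Phi s (Dt (clamp s) (g (clamp t)))).
- intros q; unfold Phi; apply cont_twist_angle; [cont|cont|].
  apply (continuous_of_on (fun q : R * C => unit_interval (fst q) /\ D (snd q))
    (fun q : R * R => (clamp (fst q), g (clamp (snd q))))
    (fun q : R * C => Dt (fst q) (snd q))); auto.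
  + cont; apply (continuous_comp (fun q : R * R => snd q) (fun t => g (clamp t))); auto; cont.
  + intros; simpl; split; auto; apply Xg; auto.
- intros s t Hs Ht; rewrite !clamp_id by auto.
  destruct (Xg t Ht) as [Dz Kz]; split.
  + apply D_twist, (proj1 (Hd s Hs)); auto.
  + intros HK; apply Kz.
    set (w := Dt s (g t)) in *.
    assert (E : Phi s w = twist (angle (a 1) (b 1)) (twist (angle (- a s) (- b s)) w)).
    { unfold Phi; rewrite twist_twist; unfold twist; do 2 f_equal; unfold angle; ring. }
    rewrite E, <- K_fibre_twist in HK by (now rewrite ?angle_1, ?angle_4).
    apply fibre_point_spec in HK as (i & Hi & HK).
    assert (Hw : w = m i s) by (rewrite Hm, <- HK, twist_angle_opp'; auto).
    destruct (Hset i s Hi Hs) as (j & Hj & Hij).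
    apply Hm0; exists j; split; auto.
    (* [Dt s] carries both [g t] and the point [m' j 0] of K to [m i s]; as it is injective on [D],
       the loop would meet K. *)
    destruct (Hd s Hs) as [(_ & _ & h & _ & _ & Hh & _) _].
    assert (D (m' j 0)) as Dm by (assert (K_fibre (m' j 0)) as (_ & ? & _) by (apply Hm0; eauto); auto).
    rewrite <- (Hh (g t)), <- (Hh (m' j 0)), HDm by auto; unfold w in Hw; congruence.
- intros s Hs; rewrite (clamp_id 0), g0, Fix by auto; apply twist_id.
  rewrite sqnorm_u0; apply angle_16.
- intros s Hs; rewrite (clamp_id 1), g1, Fix by auto; apply twist_id.
  rewrite sqnorm_u0; apply angle_16.
- intros t Ht; rewrite !clamp_id, Phi0, Hid; auto; apply Xg; auto.
- intros t Ht; rewrite !clamp_id, Phi1; auto.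
Qed.

End TwistMotion.

Lemma same_braid_trans K f f' f'' : same_braid K f f' -> same_braid K f' f'' -> same_braid K f f''.
Proof.
intros (H1 & H2 & H) (H3 & H4 & H'); split; [auto|split; [auto|]].
intros g Hg; apply path_homotopic_trans with (act f' g); [now apply H|now apply H'].
Qed.

Definition beta : C -> C := twist (angle (4 * PI) (2 * PI)).

Lemma cis_2PI : cis (2 * PI) = RtoC 1.
Proof. rewrite <- (cis_nat 1); f_equal; simpl; ring. Qed.

Lemma cis_4PI : cis (4 * PI) = RtoC 1.
Proof. rewrite <- (cis_nat 2); f_equal; simpl; ring. Qed.

Lemma braid_rep_beta : braid_rep K_fibre beta.
Proof. apply braid_rep_twist; auto using cis_2PI, cis_4PI. Qed.

Lemma E_cis t : E (cis t).
Proof. unfold E; apply Cmod_le_sqnorm; [lra|]; rewrite sqnorm_cis; lra. Qed.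

(** A motion tracing the fibres may number the points differently and may be realized by any
    isotopy, but at each time it occupies the same set of points as [m], which is all that
    [realizations_homotopic] asks. *)
Lemma local_braid_monodromy_beta b :
  local_braid_monodromy 3 S_curve b <-> same_braid K_fibre b beta.
Proof.
set (m := fun i t => twist (angle (4 * PI * t) (2 * PI * t)) (fibre_point i)).
assert (H1 : cis (4 * PI * 1) = RtoC 1) by (rewrite Rmult_1_r; apply cis_4PI).
assert (H2 : cis (2 * PI * 1) = RtoC 1) by (rewrite Rmult_1_r; apply cis_2PI).
assert (Em : forall t y, fibre S_curve (cis (2 * PI * t)) y <->
  exists i, (1 <= i <= 3)%nat /\ y = m i t).
{ intros t y; rewrite fibre_spec by apply E_cis; rewrite <- cis_add.
  replace (2 * PI * t + 2 * PI * t) with (4 * PI * t) by ring.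
  assert (m 1%nat t = (- cis (4 * PI * t))%C) as E1.
  { unfold m, twist; simpl; unfold sqnorm at 1; simpl.
    replace (-1 * -1 + 0 * 0) with 1 by ring; rewrite angle_1.
    replace (RtoC (-1)) with (- RtoC 1)%C by (apply injective_projections; simpl; ring); ring. }
  assert (m 2%nat t = (cis (4 * PI * t))%C) as E2.
  { unfold m, twist; simpl; unfold sqnorm at 1; simpl.
    replace (1 * 1 + 0 * 0) with 1 by ring; rewrite angle_1; ring. }
  assert (m 3%nat t = (RtoC 2 * cis (2 * PI * t))%C) as E3.
  { unfold m, twist; simpl; unfold sqnorm at 1; simpl.
    replace (2 * 2 + 0 * 0) with 4 by ring; now rewrite angle_4. }
  split.
  - intros [H|[H|H]]; [exists 1%nat|exists 2%nat|exists 3%nat]; split; try lia; congruence.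
  - intros (i & Hi & H); destruct (index_cases i Hi) as [->|[->| ->]]; rewrite H; auto. }
assert (Hb : beta = twist (angle (4 * PI * 1) (2 * PI * 1))) by (rewrite 2!Rmult_1_r; auto).
split.
- intros (m' & Hm' & Mm' & Dt & HDt & HS).
  apply same_braid_trans with (1 := HS); split; [apply HS|split; [apply braid_rep_beta|]].
  intros g Hg; rewrite Hb.
  apply (realizations_homotopic (fun t => 4 * PI * t) (fun t => 2 * PI * t) m) with m'; auto; cont; try ring.
  apply Hm', Em; eauto.
- intros HS; exists m; split; [auto|split].
  + apply is_motion_twist with (fun t => 4 * PI * t) (fun t => 2 * PI * t); auto; cont; ring.
  + exists (fun t => twist (angle (4 * PI * t) (2 * PI * t))); split.
    * apply realizes_twist with (a := fun t => 4 * PI * t) (b := fun t => 2 * PI * t); auto; cont; ring.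
    * now rewrite <- Hb.
Qed.

Lemma induced_braid_twist_motion_beta b :
  induced_braid 3 K_fibre twist_motion b <-> same_braid K_fibre b beta.
Proof.
(* The clamps schedule the two stages: [al] grows on the first half of [0,1] and then stays, [be]
   starts to grow at 1/2. *)
set (al := fun t => 4 * PI * clamp (2 * t)).
set (be := fun t => 2 * PI * clamp (2 * t - 1)).
assert (A1 : al 1 = 4 * PI) by (unfold al; rewrite clamp_ge by lra; ring).
assert (B1 : be 1 = 2 * PI) by (unfold be; rewrite clamp_ge by lra; ring).
assert (Hm : forall i t, (1 <= i <= 3)%nat -> unit_interval t ->
  twist_motion i t = twist (angle (al t) (be t)) (fibre_point i)).
{ intros i t Hi [Ht Ht'].
  assert (E1 : twist (angle (al t) (be t)) (RtoC (-1)) = (- cis (al t))%C).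
  { unfold twist; unfold sqnorm; simpl.
    replace (-1 * -1 + 0 * 0) with 1 by ring; rewrite angle_1.
    replace (RtoC (-1)) with (- RtoC 1)%C by (apply injective_projections; simpl; ring); ring. }
  assert (E2 : twist (angle (al t) (be t)) (RtoC 1) = cis (al t)).
  { unfold twist; unfold sqnorm; simpl.
    replace (1 * 1 + 0 * 0) with 1 by ring; rewrite angle_1; ring. }
  assert (E3 : twist (angle (al t) (be t)) (RtoC 2) = (RtoC 2 * cis (be t))%C).
  { unfold twist; unfold sqnorm; simpl.
    replace (2 * 2 + 0 * 0) with 4 by ring; now rewrite angle_4. }
  destruct (index_cases i Hi) as [->|[->| ->]]; simpl; rewrite ?E1, ?E2, ?E3;
    unfold path_concat, al, be; destruct Rle_dec;
    rewrite ?(clamp_le (2 * t - 1)), ?(clamp_ge (2 * t)) by lra;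
    rewrite ?Rmult_1_r, ?Rmult_0_r, ?cis_4PI, ?cis_0, ?clamp_id by (unfold unit_interval; lra);
    auto; apply injective_projections; simpl; ring. }
assert (Ca : forall t, continuous al t) by (unfold al; cont).
assert (Cb : forall t, continuous be t) by (unfold be; cont).
assert (A0 : al 0 = 0) by (unfold al; rewrite clamp_le by lra; ring).
assert (B0 : be 0 = 0) by (unfold be; rewrite clamp_le by lra; ring).
assert (A1' : cis (al 1) = RtoC 1) by (rewrite A1; apply cis_4PI).
assert (B1' : cis (be 1) = RtoC 1) by (rewrite B1; apply cis_2PI).
assert (Hb : beta = twist (angle (al 1) (be 1))) by (rewrite A1, B1; auto).
split.
- intros (Mm' & Dt & HDt & HS).
  apply same_braid_trans with (1 := HS); split; [apply HS|split; [apply braid_rep_beta|]].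
  intros g Hg; rewrite Hb.
  apply (realizations_homotopic al be twist_motion) with twist_motion; eauto.
- intros HS; split.
  + apply is_motion_twist with al be; auto.
  + exists (fun t => twist (angle (al t) (be t))); split.
    * apply realizes_twist; auto.
    * now rewrite <- Hb.
Qed.

(** * Polygonal paths *)

Lemma convex_disc r : convex (fun z => sqnorm z <= r).
Proof.
intros y z s Hy Hz [H0 H1]; unfold sqnorm in *; simpl.
apply Rle_trans with ((1 - s) * (fst y * fst y + snd y * snd y) + s * (fst z * fst z + snd z * snd z)); [|nra].
(* The gap in the convexity inequality is s (1 - s) |y - z|^2. *)
assert (0 <= s * (1 - s)) by nra.
pose proof (Rle_0_sqr (fst y - fst z)); pose proof (Rle_0_sqr (snd y - snd z)); unfold Rsqr in *; nra.
Qed.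

Lemma segment_0 a b : segment a b 0 = a.
Proof. unfold segment; ring. Qed.

Lemma segment_1 a b : segment a b 1 = b.
Proof. unfold segment; ring. Qed.

Lemma path_inv_segment a b t : path_inv (segment a b) t = segment b a t.
Proof. unfold path_inv, segment; rewrite RtoC_minus; ring. Qed.

Lemma last_cons (a b : C) l : last (b :: l) a = last l b.
Proof.
revert a b; induction l as [|c l IH]; intros a b; auto.
change (last (c :: l) a = last (c :: l) b); now rewrite 2!IH.
Qed.

Section Polygons.
Variable X : C -> Prop.

Definition in_triangle (a b c z : C) : Prop :=
  exists r s t, 0 <= r /\ 0 <= s /\ 0 <= t /\ r + s + t = 1 /\
    z = (RtoC r * a + RtoC s * b + RtoC t * c)%C.

Definition triangle_in (a b c : C) : Prop := forall z, in_triangle a b c z -> X z.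

Lemma convex_triangle a b c : convex (in_triangle a b c).
Proof.
intros z w h (r & s & t & Hr & Hs & Ht & E & ->) (r' & s' & t' & Hr' & Hs' & Ht' & E' & ->) [H0 H1].
exists ((1 - h) * r + h * r'), ((1 - h) * s + h * s'), ((1 - h) * t + h * t').
repeat split; try nra.
rewrite !RtoC_plus, !RtoC_mult; ring.
Qed.

Lemma in_triangle_ab a b c t : unit_interval t -> in_triangle a b c (segment a b t).
Proof.
intros [H0 H1]; exists (1 - t), t, 0; repeat split; try lra.
unfold segment; rewrite RtoC_minus; ring.
Qed.

Lemma in_triangle_bc a b c t : unit_interval t -> in_triangle a b c (segment b c t).
Proof.
intros [H0 H1]; exists 0, (1 - t), t; repeat split; try lra.
unfold segment; rewrite RtoC_minus; ring.
Qed.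

Lemma in_triangle_ac a b c t : unit_interval t -> in_triangle a b c (segment a c t).
Proof.
intros [H0 H1]; exists (1 - t), 0, t; repeat split; try lra.
unfold segment; rewrite RtoC_minus; ring.
Qed.

Definition segment_in (a b : C) : Prop := forall t, unit_interval t -> X (segment a b t).

Lemma is_path_segment (Y : C -> Prop) a b : (forall t, unit_interval t -> Y (segment a b t)) ->
  is_path Y a b (segment a b).
Proof.
intros H; apply is_path_intro; auto using segment_0, segment_1; unfold segment; cont.
Qed.

Lemma path_homotopic_triangle a b c : triangle_in a b c ->
  path_homotopic X a c (path_concat (segment a b) (segment b c)) (segment a c).
Proof.
intros H; apply (path_homotopic_convex (in_triangle a b c) X (fun z => z)); auto.
- apply convex_triangle.
- cont.
- apply is_path_concat with b; apply is_path_segment;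
    [apply in_triangle_ab|apply in_triangle_bc].
- apply is_path_segment, in_triangle_ac.
Qed.

Fixpoint poly (a : C) (l : list C) : R -> C :=
  match l with
  | [] => fun _ => a
  | b :: l => path_concat (segment a b) (poly b l)
  end.

Fixpoint poly_in (a : C) (l : list C) : Prop :=
  match l with
  | [] => X a
  | b :: l => segment_in a b /\ poly_in b l
  end.

Lemma is_path_poly a l : poly_in a l -> is_path X a (last l a) (poly a l).
Proof.
revert a; induction l as [|b l IH]; intros a Hl; simpl poly.
- now apply is_path_const.
- destruct Hl as [Hab Hl]; apply is_path_concat with b; [now apply is_path_segment|].
  rewrite last_cons; auto.
Qed.

Lemma poly_start a l : poly a l 0 = a.
Proof.
destruct l as [|b l]; auto; simpl; unfold path_concat; destruct Rle_dec; [|lra].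
rewrite Rmult_0_r; apply segment_0.
Qed.

(** Lets a polygon known only as a path in [X], for instance as one end of a homotopy, enter the
    calculus of vertex lists. *)
Lemma poly_in_of_image a l : (forall t, unit_interval t -> X (poly a l t)) -> poly_in a l.
Proof.
revert a; induction l as [|b l IH]; intros a H; simpl in *; [now apply (H 0)|split].
- intros t [H0 H1]; specialize (H (t / 2) ltac:(unfold unit_interval; lra)).
  unfold path_concat in H; destruct Rle_dec; [|lra]; now replace (2 * (t / 2)) with t in H by lra.
- apply IH; intros t [H0 H1].
  specialize (H ((t + 1) / 2) ltac:(unfold unit_interval; lra)); unfold path_concat in H; destruct Rle_dec.
  + replace t with 0 by lra; replace (2 * ((t + 1) / 2)) with 1 in H by lra.
    now rewrite poly_start; rewrite segment_1 in H.
  + now replace (2 * ((t + 1) / 2) - 1) with t in H by lra.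
Qed.

Lemma poly_app a l b l' : poly_in a l -> last l a = b -> poly_in b l' ->
  path_homotopic X a (last l' b) (path_concat (poly a l) (poly b l')) (poly a (l ++ l')).
Proof.
revert a; induction l as [|c l IH]; intros a; simpl poly.
- simpl; intros Ha -> Hl'; now apply path_homotopic_id_l, is_path_poly.
- intros [Hac Hl] Hb Hl'; rewrite last_cons in Hb.
  pose proof (is_path_segment X a c Hac) as Ps.
  pose proof (is_path_poly _ _ Hl) as Pl; rewrite Hb in Pl; pose proof (is_path_poly _ _ Hl') as Pl'.
  apply path_homotopic_trans with (path_concat (segment a c) (path_concat (poly c l) (poly b l'))).
  + now apply path_homotopic_assoc with c b.
  + apply path_homotopic_concat with c; [now apply path_homotopic_refl|now apply IH].
Qed.

Lemma path_homotopic_segment_poly a b : segment_in a b ->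
  path_homotopic X a b (segment a b) (poly a [b]).
Proof.
intros H; apply path_homotopic_sym, path_homotopic_id_r; now apply is_path_segment.
Qed.

(** Polygons with [poly_eq] vertex lists have homotopic parametrizations. It is
    generated by inserting or deleting a vertex, as in [poly_eq_del]. *)
Definition poly_eq (a : C) (l l' : list C) : Prop :=
  last l a = last l' a /\ (poly_in a l <-> poly_in a l') /\
  (poly_in a l -> path_homotopic X a (last l a) (poly a l) (poly a l')).

Lemma poly_eq_refl a l : poly_eq a l l.
Proof.
split; [auto|split; [tauto|]].
intros Hl; now apply path_homotopic_refl, is_path_poly.
Qed.

Lemma poly_eq_sym a l l' : poly_eq a l l' -> poly_eq a l' l.
Proof.
intros (H1 & H2 & H3); split; [auto|split; [tauto|]].
intros Hl; rewrite <- H1; apply path_homotopic_sym; tauto.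
Qed.

Lemma poly_eq_trans a l l' l'' : poly_eq a l l' -> poly_eq a l' l'' -> poly_eq a l l''.
Proof.
intros (H1 & H2 & H3) (K1 & K2 & K3); split; [congruence|split; [tauto|]].
intros Hl; apply path_homotopic_trans with (poly a l'); [tauto|].
rewrite H1; tauto.
Qed.

Lemma poly_eq_cons a b l l' : poly_eq b l l' -> poly_eq a (b :: l) (b :: l').
Proof.
intros (H1 & H2 & H3); split; [now rewrite !last_cons|split; [simpl; tauto|]].
intros [Hab Hl]; simpl poly; rewrite last_cons; apply path_homotopic_concat with b; auto.
now apply path_homotopic_refl, is_path_segment.
Qed.

Lemma poly_eq_del a b c l : triangle_in a b c -> poly_eq a (b :: c :: l) (c :: l).
Proof.
intros H; split; [|split].
- now rewrite !last_cons.
- simpl; split; [intros (H1 & H2 & H3)|intros [H1 H2]]; repeat split; auto; intros t Ht; apply H.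
  + now apply in_triangle_ac.
  + now apply in_triangle_ab.
  + now apply in_triangle_bc.
- intros (H1 & H2 & H3); rewrite !last_cons; simpl poly.
  apply path_homotopic_trans with (path_concat (path_concat (segment a b) (segment b c)) (poly c l)).
  + apply path_homotopic_sym, path_homotopic_assoc with b c;
      [now apply is_path_segment|now apply is_path_segment|now apply is_path_poly].
  + apply path_homotopic_concat with c; [now apply path_homotopic_triangle|].
    now apply path_homotopic_refl, is_path_poly.
Qed.

Definition sg (a b : C) (H : segment_in a b) : path X a b :=
  Path (segment a b) (is_path_segment X a b H).

Definition pol (a : C) (l : list C) (H : poly_in a l) : path X a (last l a) :=
  Path (poly a l) (is_path_poly a l H).

Lemma pinv_sg a b H H' : peq (pinv (sg a b H)) (sg b a H').
Proof. apply path_homotopic_ext; [apply pfun_path|]; intros; apply path_inv_segment. Qed.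

(** The hypothesis covers the region between the circle and its inscribed square. *)
Lemma path_homotopic_circle (p v : C) :
  (forall z, 1 <= Rabs (fst z) + Rabs (snd z) -> sqnorm z <= 1 -> X (p + v * z)%C) ->
  path_homotopic X (p + v)%C (p + v)%C (fun t => p + v * cis (2 * PI * t))%C
    (poly (p + v)%C [p + v * Ci; p - v; p - v * Ci; p + v])%C.
Proof.
intros HX.
(* One quarter at a time: the arc and the chord from 1 to i lie in the convex cap x + y >= 1, |z| <=
   1, and multiplication by [w], a power of i, carries it to the other three caps. *)
assert (Harc : forall k (w : C), w = cis (PI / 2 * k) ->
  w = RtoC 1 \/ w = Ci \/ w = (- RtoC 1)%C \/ w = (- Ci)%C ->
  path_homotopic X (p + v * w)%C (p + v * (w * Ci))%C
    (fun t => p + v * cis (PI / 2 * (k + t)))%C (segment (p + v * w) (p + v * (w * Ci)))%C).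
{ intros k w Hw Hw'.
  set (f := fun z => (p + v * (w * z))%C).
  assert (HI : forall z : C, (p + v * (w * z))%C = f z) by reflexivity.
  replace (p + v * w)%C with (f (RtoC 1)) by (unfold f; ring).
  rewrite HI.
  apply path_homotopic_cast with (fun t => f (cis (PI / 2 * t))) (fun t => f (segment (RtoC 1) Ci t)).
  - apply (path_homotopic_convex (fun z => 1 <= fst z + snd z /\ sqnorm z <= 1)).
    + intros y z s [Hy Hy'] [Hz Hz'] Hs; split; [destruct Hs; simpl; nra|now apply convex_disc].
    + intros z; unfold f; cont.
    + intros z [H1 H2]; unfold f; apply HX.
      * apply Rle_trans with (1 := H1).
        destruct Hw' as [->|[->|[->| ->]]]; simpl; unfold Rabs; repeat destruct Rcase_abs; lra.
      * rewrite sqnorm_mult, Hw, sqnorm_cis; lra.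
    + apply is_path_intro; [cont| | |].
      * intros t [H0 H1]; rewrite sqnorm_cis; split; [|lra]; simpl.
        pose proof PI_RGT_0.
        assert (0 <= cos (PI / 2 * t)) by (apply cos_ge_0; nra).
        assert (0 <= sin (PI / 2 * t)) by (apply sin_ge_0; nra).
        pose proof (sin2_cos2 (PI / 2 * t)); unfold Rsqr in *; nra.
      * rewrite Rmult_0_r; apply cis_0.
      * rewrite Rmult_1_r; unfold cis; now rewrite cos_PI2, sin_PI2.
    + apply is_path_segment; intros t [H0 H1]; unfold segment, sqnorm; simpl; split; nra.
  - intros t Ht; unfold f; rewrite Hw, <- cis_add; do 3 f_equal; ring.
  - intros t Ht; unfold f, segment; ring. }
assert (C1 : cis (PI / 2 * 1) = Ci) by (rewrite Rmult_1_r; unfold cis; now rewrite cos_PI2, sin_PI2).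
assert (C0 : cis (PI / 2 * 0) = RtoC 1) by (rewrite Rmult_0_r; apply cis_0).
assert (Ci2 : (Ci * Ci)%C = (- RtoC 1)%C) by (apply injective_projections; simpl; ring).
assert (C2 : cis (PI / 2 * 2) = (- RtoC 1)%C).
{ replace (PI / 2 * 2) with (PI / 2 * 1 + PI / 2 * 1) by ring; now rewrite cis_add, C1. }
assert (C3 : cis (PI / 2 * 3) = (- Ci)%C).
{ replace (PI / 2 * 3) with (PI / 2 * 2 + PI / 2 * 1) by ring; rewrite cis_add, C1, C2; ring. }
pose proof (Harc 0 _ (eq_sym C0) (or_introl eq_refl)) as A0.
pose proof (Harc 1 _ (eq_sym C1) (or_intror (or_introl eq_refl))) as A1.
pose proof (Harc 2 _ (eq_sym C2) (or_intror (or_intror (or_introl eq_refl)))) as A2.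
pose proof (Harc 3 _ (eq_sym C3) (or_intror (or_intror (or_intror eq_refl)))) as A3.
replace (p + v * RtoC 1)%C with (p + v)%C in A0 by ring.
replace (p + v * (RtoC 1 * Ci))%C with (p + v * Ci)%C in A0 by ring.
rewrite Ci2 in A1; replace (p + v * (- RtoC 1))%C with (p - v)%C in A1, A2 by ring.
replace (p + v * (- RtoC 1 * Ci))%C with (p - v * Ci)%C in A2 by ring.
replace (p + v * (- Ci))%C with (p - v * Ci)%C in A3 by ring.
replace (- Ci * Ci)%C with (RtoC 1) in A3 by (apply injective_projections; simpl; ring).
replace (p + v * RtoC 1)%C with (p + v)%C in A3 by ring.
(* Bracketed in pairs, the arcs occupy the four quarters of [0,1] exactly as they do in the circle,
   so the two agree pointwise; the bracketing of [poly] is reached afterwards. *)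
pose proof (path_homotopic_concat _ _ _ _ _ _ _ _
  (path_homotopic_concat _ _ _ _ _ _ _ _ A0 A1) (path_homotopic_concat _ _ _ _ _ _ _ _ A2 A3)) as HA.
apply path_homotopic_trans with (path_concat (path_concat (segment (p + v) (p + v * Ci)) (segment (p + v * Ci) (p - v)))
  (path_concat (segment (p - v) (p - v * Ci)) (segment (p - v * Ci) (p + v))))%C.
- apply path_homotopic_cast with (1 := HA); auto.
  intros t Ht; unfold path_concat; repeat destruct Rle_dec; try lra; do 3 f_equal; field.
- apply path_homotopic_is_path in A0 as [_ A0]; apply path_homotopic_is_path in A1 as [_ A1].
  apply path_homotopic_is_path in A2 as [_ A2]; apply path_homotopic_is_path in A3 as [_ A3].
  change (peq (pcat (pcat (Path _ A0) (Path _ A1)) (pcat (Path _ A2) (Path _ A3)))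
    (pcat (Path _ A0) (pcat (Path _ A1) (pcat (Path _ A2) (pcat (Path _ A3) (pid X _ (path_end _ _ _ (Path _ A3)))))))).
  now rewrite pcatp1, pcatA.
Qed.
End Polygons.

(** * The punctured disc *)

Local Notation X := (punctured K_fibre).

Lemma punctured_spec z : X z <->
  sqnorm z <= 16 /\ ~ (snd z = 0 /\ (fst z = -1 \/ fst z = 1 \/ fst z = 2)).
Proof.
unfold punctured; rewrite D_sqnorm, K_fibre_spec; destruct z as [x y]; simpl.
split; intros [H HK]; split; auto; intros H'; apply HK.
- destruct H' as [-> [->|[->| ->]]]; auto.
- destruct H' as [H'|[H'|H']]; injection H' as -> ->; auto.
Qed.

Lemma sqnorm_comb3 a b c r s t : 0 <= r -> 0 <= s -> 0 <= t -> r + s + t = 1 ->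
  sqnorm a <= 16 -> sqnorm b <= 16 -> sqnorm c <= 16 ->
  sqnorm (RtoC r * a + RtoC s * b + RtoC t * c)%C <= 16.
Proof.
intros Hr Hs Ht E Ha Hb Hc.
destruct (Req_dec t 1) as [->|Ht1].
- assert (r = 0) as -> by lra; assert (s = 0) as -> by lra.
  replace (_ + _)%C with c by ring; auto.
- replace (RtoC r * a + RtoC s * b + RtoC t * c)%C with
    (RtoC (1 - t) * (RtoC (1 - s / (1 - t)) * a + RtoC (s / (1 - t)) * b) + RtoC t * c)%C.
  + apply (convex_disc 16); [apply (convex_disc 16)| |]; auto; unfold unit_interval; [|lra].
    split; [apply Rdiv_le_0_compat; lra|].
    apply (Rmult_le_reg_r (1 - t)); [lra|]; unfold Rdiv; rewrite Rmult_assoc, Rinv_l; lra.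
  + apply injective_projections; simpl; replace r with (1 - t - s) by lra; field; lra.
Qed.

(** It suffices to look at the intersection of the triangle with the real axis. *)
Lemma triangle_in_punctured a b c : sqnorm a <= 16 -> sqnorm b <= 16 -> sqnorm c <= 16 ->
  (forall r s t, 0 <= r -> 0 <= s -> 0 <= t -> r + s + t = 1 ->
     r * snd a + s * snd b + t * snd c = 0 ->
     r * fst a + s * fst b + t * fst c <> -1 /\
     r * fst a + s * fst b + t * fst c <> 1 /\
     r * fst a + s * fst b + t * fst c <> 2) -> triangle_in X a b c.
Proof.
intros Ha Hb Hc H z (r & s & t & Hr & Hs & Ht & E & ->); apply punctured_spec; split.
- now apply sqnorm_comb3.
- intros [H1 H2].
  destruct (H r s t) as (N1 & N2 & N3); auto; simpl in *; [lra|].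
  destruct H2 as [H2|[H2|H2]]; [apply N1|apply N2|apply N3]; lra.
Qed.

Lemma segment_in_triangle a b : triangle_in X a b b -> segment_in X a b.
Proof. intros H t Ht; apply H; now apply in_triangle_ab. Qed.

(** The inner disc of the twist contains [pm], [pA], [pB], [pA'], its ring
    [pn], [pk], [pF], [pG] and the triangle with vertices [pn], [pF], [pG]. *)
Definition pn : C := (0, -3).
Definition pk : C := (0, - (135 / 100)).
Definition pm : C := (0, - (13 / 10)).
Definition pA : C := (13 / 10, 0).
Definition pB : C := (0, 13 / 10).
Definition pA' : C := (- (13 / 10), 0).
Definition pF : C := (3, 0).
Definition pG : C := (2, 1).

(** The vertices of a small square around [p] with one vertex on the segment
    from [p] to [u0]. *)
Definition sq0 (p : R) : C := (99/100 * p, -4/100).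
Definition sq1 (p : R) : C := (p + 4/100, - (p / 100)).
Definition sq2 (p : R) : C := (101/100 * p, 4/100).
Definition sq3 (p : R) : C := (p - 4/100, p / 100).

Definition gbase_square (p : R) : list C := [sq0 p; sq1 p; sq2 p; sq3 p; sq0 p; u0].

Ltac points := unfold sq0, sq1, sq2, sq3, pn, pk, pm, pA, pB, pA', pF, pG, u0, sqnorm; cbn [fst snd].
(** With numerical vertices, all conditions are linear in the barycentric coordinates. *)
Ltac triangle := apply triangle_in_punctured;
  [points; lra|points; lra|points; lra|
   points; intros r s t ? ? ? ? ?; (split; [|split]); intro; lra].
Ltac edge := apply segment_in_triangle; triangle.

(* Positions count from 0 in the vertex list, which omits the starting point. Each move costs one
   triangle, spanned by the vertex and its two neighbours. *)
Tactic Notation "del" integer(k) :=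
  eapply poly_eq_trans; [do k apply poly_eq_cons; apply poly_eq_del; triangle|].
Tactic Notation "ins" integer(k) constr(b) :=
  eapply poly_eq_trans;
  [do k apply poly_eq_cons; apply poly_eq_sym; apply (poly_eq_del X _ b); triangle|].

(** The tail, which lies on the imaginary axis, is straightened; then the corners of the triangle
    are exchanged for those of the square, each new corner being inserted before the old one is
    deleted, so that no move crosses a puncture. *)
Lemma polygon_1 : poly_eq X u0 [pn; pk; pm; pB; pA'; pm; pk; pn; u0] (gbase_square (-1)).
Proof.
del 1. del 0. del 4. del 4. ins 1 (sq1 (-1)). ins 3 (sq2 (-1)). del 2.
ins 4 (sq3 (-1)). del 3. ins 4 (sq0 (-1)). del 5. ins 1 (sq0 (-1)). del 0.
apply poly_eq_refl.
Qed.

Lemma polygon_2 : poly_eq X u0 [pn; pk; pm; pA; pB; pm; pk; pn; u0] (gbase_square 1).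
Proof.
del 1. del 0. del 4. del 4. ins 1 (sq1 1). ins 3 (sq2 1). del 2.
ins 4 (sq3 1). del 3. ins 4 (sq0 1). del 5. ins 1 (sq0 1). del 0.
apply poly_eq_refl.
Qed.

Lemma polygon_3 : poly_eq X u0 [pn; pF; pG; pn; u0] (gbase_square 2).
Proof.
ins 1 (sq1 2). ins 3 (sq2 2). del 2. ins 4 (sq3 2). del 3.
ins 4 (sq0 2). del 5. ins 1 (sq0 2). del 0.
apply poly_eq_refl.
Qed.

(** The two triangles share the side between [pB] and [pm], which the first loop ends with and the
    second retraces. *)
Lemma polygon_12 : poly_eq X pm [pA; pB; pm; pB; pA'; pm] [pA; pB; pA'; pm].
Proof. del 2. del 1. apply poly_eq_refl. Qed.

(** After the backtracking along the imaginary axis is removed, the two loops are merged through the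
    gap between 1 and 2, crossed by the edge from [pG] to [pn] at 3/2; the result is pushed out to
    the square inscribed in the boundary. *)
Lemma polygon_123 :
  poly_eq X u0 [pn; pF; pG; pn; u0; pn; pk; pm; pA; pB; pA'; pm; pk; pn; u0]
    [(4, 0); (0, 4); (-4, 0); u0].
Proof.
del 4. del 4. del 4. del 9. del 9.
del 0. del 2. del 2. del 2. del 4.
ins 0 (4, 0). del 1. ins 2 (0, 4). del 1.
ins 4 (-4, 0). del 3. del 2.
apply poly_eq_refl.
Qed.

(** * Loops of the g-base as small squares *)

Section GBase.
Variable p : R.
Hypothesis Hp : p = -1 \/ p = 1 \/ p = 2.
Let w : C := (u0 - RtoC p)%C.

Lemma punctured_near z : 0 < sqnorm z < 1 -> X (RtoC p + z)%C.
Proof.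
destruct z as [x y]; unfold sqnorm; simpl; intros Hz; apply punctured_spec; unfold sqnorm; simpl; split.
- destruct Hp as [->|[->| ->]]; nra.
- intros [H1 H2]; assert (y = 0) as -> by lra.
  destruct Hp as [->|[->| ->]]; destruct H2 as [H2|[H2|H2]]; nra.
Qed.

Lemma punctured_spoke h : 0 < h <= 1 -> X (RtoC p + RtoC h * w)%C.
Proof.
intros Hh; apply punctured_spec; unfold sqnorm, w, u0; simpl; split; [|lra].
destruct Hp as [->|[->| ->]]; nra.
Qed.

Lemma sqnorm_w : 17 <= sqnorm w <= 20.
Proof. unfold sqnorm, w, u0; simpl; destruct Hp as [->|[->| ->]]; lra. Qed.

(** As |w|^2 <= 20, a factor at most 1/8 gives a radius below 1, the least distance between points
    of K. *)
Lemma punctured_ring h th : 0 < h <= 1/8 -> X (RtoC p + RtoC h * w * cis th)%C.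
Proof.
intros Hh; apply punctured_near; rewrite !sqnorm_mult, sqnorm_cis; pose proof sqnorm_w.
unfold sqnorm at 1 3; simpl; nra.
Qed.

(** In polar coordinates both sides become paths from (h, 0) to (h, 2 pi) in a strip, one straight
    and the other with a detour through radius h'. *)
Lemma shrink_circle h h' (q := (RtoC p + RtoC h * w)%C) (q' := (RtoC p + RtoC h' * w)%C) :
  0 < h <= 1/8 -> 0 < h' <= 1/8 ->
  path_homotopic X q q (fun t => RtoC p + RtoC h * w * cis (2 * PI * t))%C
    (path_concat (path_concat (segment q q') (fun t => RtoC p + RtoC h' * w * cis (2 * PI * t))%C)
       (path_inv (segment q q'))).
Proof.
intros Hh Hh'.
set (f := fun z : C => (RtoC p + RtoC (fst z) * w * cis (snd z))%C).
assert (C2 : cis (2 * PI) = RtoC 1) by apply cis_2PI.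
assert (E0 : f (h, 0) = q) by (unfold f, q; simpl; rewrite cis_0; ring).
assert (E1 : f (h, 2 * PI) = q) by (unfold f, q; simpl; rewrite C2; ring).
rewrite <- E0 at 1; rewrite <- E1 at 1.
apply path_homotopic_cast with (fun t => f (h, 2 * PI * t))
  (fun t => f (path_concat (path_concat (fun t => (h + t * (h' - h), 0)) (fun t => (h', 2 * PI * t)))
     (fun t => (h' + t * (h - h'), 2 * PI)) t)).
- apply (path_homotopic_convex (fun z => 0 < fst z <= 1/8)).
  + intros y z s Hy Hz [H0 H1]; simpl.
    destruct (Req_dec s 0) as [->|Hs]; [lra|split; [nra|nra]].
  + intros z; unfold f; cont.
  + intros z Hz; now apply punctured_ring.
  + apply is_path_intro; [cont|simpl; auto| |]; apply injective_projections; simpl; ring.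
  + apply is_path_concat with (h', 2 * PI); [apply is_path_concat with (h', 0)|].
    * apply is_path_intro; [cont|simpl; intros t [? ?]; nra| |]; apply injective_projections; simpl; ring.
    * apply is_path_intro; [cont|simpl; auto| |]; apply injective_projections; simpl; ring.
    * apply is_path_intro; [cont|simpl; intros t [? ?]; nra| |]; apply injective_projections; simpl; ring.
- reflexivity.
- intros t Ht; rewrite path_concat_map; apply path_concat_ext; auto.
  + intros s Hs; rewrite path_concat_map; apply path_concat_ext; auto.
    intros x Hx; unfold f, q, q', segment; simpl; rewrite cis_0, RtoC_plus, RtoC_mult, RtoC_minus; ring.
  + intros s Hs; unfold f, q, q', path_inv, segment; simpl.
    rewrite C2, RtoC_plus, RtoC_mult, !RtoC_minus; ring.
Qed.

Lemma segment_spoke h t : segment u0 (RtoC p + RtoC h * w) t = (RtoC p + RtoC (1 - t * (1 - h)) * w)%C.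
Proof. unfold segment, w; rewrite RtoC_minus, RtoC_mult, RtoC_minus; ring. Qed.

Lemma is_path_spoke h : 0 < h <= 1 ->
  is_path X u0 (RtoC p + RtoC h * w)%C (segment u0 (RtoC p + RtoC h * w)%C).
Proof.
intros Hh; apply is_path_segment; intros t [H0 H1]; rewrite segment_spoke.
apply punctured_spoke; nra.
Qed.

Lemma spoke_extend h h' : 0 < h <= 1 -> 0 < h' <= 1 ->
  path_homotopic X u0 (RtoC p + RtoC h' * w)%C
    (path_concat (segment u0 (RtoC p + RtoC h * w)%C)
       (segment (RtoC p + RtoC h * w) (RtoC p + RtoC h' * w))%C)
    (segment u0 (RtoC p + RtoC h' * w)%C).
Proof.
intros Hh Hh'; apply path_homotopic_triangle.
intros z (r & s & t & Hr & Hs & Ht & E & ->).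
replace (_ + _)%C with (RtoC p + RtoC (r + s * h + t * h') * w)%C.
- apply punctured_spoke.
  destruct (Req_dec r 0) as [->|]; [destruct (Req_dec s 0) as [->|]|]; nra.
- rewrite !RtoC_plus, !RtoC_mult; replace r with (1 - s - t) by lra; rewrite !RtoC_minus.
  unfold w; ring.
Qed.

(** The radius [r] is arbitrary, whereas the square has a fixed size. From r < 1/2 and |w| > 4 the
    factor r / |w| is at most 1/8, so [shrink_circle] can bring the circle to the factor 1/100;
    [spoke_extend] absorbs the change of spoke, and the circle is replaced by its inscribed
    square. *)
Lemma gbase_loop_square r (v := (RtoC (1 / 100) * w)%C) (q := (RtoC p + v)%C) : 0 < r < 1/2 ->
  path_homotopic X u0 u0 (gbase_loop r (RtoC p))
    (poly u0 [q; RtoC p + v * Ci; RtoC p - v; RtoC p - v * Ci; q; u0])%C.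
Proof.
intros Hr.
assert (Hm : 4 < Cmod w).
{ destruct (Rle_dec (Cmod w) 4) as [H|H]; [|lra].
  apply Cmod_le_sqnorm in H; [|lra]; pose proof sqnorm_w; lra. }
set (h := r / Cmod w).
assert (Hh : 0 < h <= 1/8).
{ unfold h; split; [apply Rdiv_lt_0_compat; lra|].
  apply (Rmult_le_reg_r (Cmod w)); [lra|]; unfold Rdiv at 1; rewrite Rmult_assoc, Rinv_l; lra. }
set (q0 := (RtoC p + RtoC h * w)%C).
pose proof (is_path_spoke h ltac:(lra)) as P0; fold q0 in P0.
pose proof (is_path_spoke (1/100) ltac:(lra)) as P1; fold v q in P1.
pose proof (shrink_circle h (1/100) Hh ltac:(lra)) as HS; cbv zeta in HS; fold v q q0 in HS.
pose proof (spoke_extend h (1/100) ltac:(lra) ltac:(lra)) as HE; fold v q q0 in HE.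
pose proof (path_homotopic_circle X (RtoC p) v) as HC.
assert (HQ : segment_in X q0 q).
{ intros t [? ?]; unfold segment.
  replace (_ + _)%C with (RtoC p + RtoC (h + t * (1/100 - h)) * w * cis 0)%C.
  - apply punctured_ring; nra.
  - unfold q, q0, v; rewrite cis_0, RtoC_plus, RtoC_mult, RtoC_minus; ring. }
assert (HC' : path_homotopic X q q (fun t => RtoC p + v * cis (2 * PI * t))%C
  (poly q [RtoC p + v * Ci; RtoC p - v; RtoC p - v * Ci; q])%C).
{ apply HC; intros z Hz Hz'; apply punctured_near.
  unfold v; rewrite !sqnorm_mult; pose proof sqnorm_w as Hw.
  assert (1/2 <= sqnorm z).
  { unfold sqnorm; pose proof (Rle_0_sqr (Rabs (fst z) - Rabs (snd z))); unfold Rsqr in *.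
    assert (A0 : forall x, x * x = Rabs x * Rabs x).
    { intros x; rewrite <- Rabs_mult, Rabs_pos_eq; auto; nra. }
    rewrite (A0 (fst z)), (A0 (snd z)); nra. }
  unfold sqnorm at 1 4; simpl; split; [|nra].
  apply Rmult_lt_0_compat; [|lra]; apply Rmult_lt_0_compat; lra. }
destruct (path_homotopic_is_path _ _ _ _ _ HS) as [PC0 _].
destruct (path_homotopic_is_path _ _ _ _ _ HC') as [PC1 PC2].
set (a0 := Path _ P0 : path X u0 q0); set (a1 := Path _ P1 : path X u0 q).
set (b := sg X q0 q HQ); set (c0 := Path _ PC0 : path X q0 q0).
set (c1 := Path _ PC1 : path X q q); set (c2 := Path _ PC2 : path X q q).
apply path_homotopic_trans with (pfun (pcat (pcat a1 c2) (pinv a1))).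
- apply path_homotopic_trans with (pfun (pcat (pcat a0 c0) (pinv a0))).
  + apply path_homotopic_ext.
    * unfold gbase_loop; fold w h q0.
      apply is_path_concat with q0; [apply is_path_concat with q0|apply is_path_inv]; auto.
      apply is_path_ext with (2 := PC0); intros; unfold q0; ring.
    * intros t Ht; unfold gbase_loop; fold w h q0; apply path_concat_ext; auto.
      intros s Hs; apply path_concat_ext; auto; intros x _; simpl; unfold q0; ring.
  + change (peq (pcat (pcat a0 c0) (pinv a0)) (pcat (pcat a1 c2) (pinv a1))).
    assert (peq c0 (pcat (pcat b c1) (pinv b))) as -> by exact HS.
    assert (peq c2 c1) as -> by (symmetry; exact HC').
    assert (peq a1 (pcat a0 b)) as -> by (symmetry; exact HE).
    now rewrite pinvM, !pcatA.
- assert (HB : segment_in X q u0).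
  { intros t Ht; rewrite <- path_inv_segment; apply P1; unfold unit_interval in *; lra. }
  set (l := [RtoC p + v * Ci; RtoC p - v; RtoC p - v * Ci; q]%C) in *.
  assert (Hl : poly_in X q l) by (apply poly_in_of_image, PC2).
  pose proof (poly_app X q l q [u0] Hl eq_refl (conj HB (path_start _ _ _ a0))) as HA.
  simpl last in HA; destruct (path_homotopic_is_path _ _ _ _ _ HA) as [_ PA].
  pose proof (path_homotopic_segment_poly X q u0 HB) as HI.
  destruct (path_homotopic_is_path _ _ _ _ _ HI) as [_ PI].
  change (peq (pcat (pcat a1 c2) (pinv a1)) (pcat a1 (Path _ PA : path X q u0))).
  assert (peq (Path _ PA : path X q u0) (pcat c2 (Path _ PI : path X q u0))) as ->
    by (symmetry; exact HA).
  assert (peq (Path _ PI : path X q u0) (sg X q u0 HB)) as -> by (symmetry; exact HI).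
  assert (peq (sg X q u0 HB) (pinv a1)) as ->.
  { apply path_homotopic_ext; [apply pfun_path|]; intros; symmetry; apply path_inv_segment. }
  apply pcatA.
Qed.
End GBase.

(** * Action of beta *)

Lemma punctured_twist psi z : cis (psi 1) = RtoC 1 -> cis (psi 4) = RtoC 1 -> X z -> X (twist psi z).
Proof. intros H1 H4 [HD HK]; split; [now apply D_twist|now rewrite <- K_fibre_twist]. Qed.

(** The angles are interpolated linearly. On the circles through K the angle stays constant, so
    every intermediate twist fixes K pointwise; at the radii of [a] and [b] it stays constant too,
    so the endpoints do not move. *)
Lemma twist_homotopic psi psi' a b g :
  (forall w, continuous psi w) -> (forall w, continuous psi' w) ->
  cis (psi 1) = RtoC 1 -> cis (psi 4) = RtoC 1 ->
  psi 1 = psi' 1 -> psi 4 = psi' 4 ->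
  psi (sqnorm a) = psi' (sqnorm a) -> psi (sqnorm b) = psi' (sqnorm b) ->
  is_path X a b g ->
  path_homotopic X (twist psi a) (twist psi b) (act (twist psi) g) (act (twist psi') g).
Proof.
intros Cp Cp' K1 K4 E1 E4 Ea Eb Hg; pose proof (is_path_clamp _ _ _ _ Hg) as Cg.
destruct Hg as (_ & Xg & g0 & g1).
set (h := fun s w => psi w + s * (psi' w - psi w)).
assert (Eh : forall s w, psi w = psi' w -> h s w = psi w) by (intros s w H; unfold h; rewrite H; ring).
apply path_homotopic_intro with (fun s t => twist (h s) (g (clamp t))).
- intros q; unfold twist, h.
  assert (Cs : continuous (fun q : R * R => sqnorm (g (clamp (snd q)))) q).
  { apply cont_sqnorm; apply (continuous_comp (fun q : R * R => snd q) (fun t => g (clamp t))); auto; cont. }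
  assert (continuous (fun q : R * R => g (clamp (snd q))) q).
  { apply (continuous_comp (fun q : R * R => snd q) (fun t => g (clamp t))); auto; cont. }
  pose proof (continuous_comp _ psi _ Cs (Cp _)); pose proof (continuous_comp _ psi' _ Cs (Cp' _)).
  apply cont_Cmult; auto; apply cont_cis, cont_Rplus; auto; apply cont_Rmult; [cont|].
  apply cont_Rminus; auto.
- intros s t Hs Ht; rewrite clamp_id by auto; apply punctured_twist; rewrite ?Eh; auto.
- intros s Hs; rewrite clamp_id, g0 by auto; unfold twist; now rewrite Eh.
- intros s Hs; rewrite clamp_id, g1 by auto; unfold twist; now rewrite Eh.
- intros t Ht; rewrite clamp_id by auto; unfold act, twist, h; do 2 f_equal; ring.
- intros t Ht; rewrite clamp_id by auto; unfold act, twist, h; do 2 f_equal; ring.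
Qed.

Section Action.
Local Open Scope path_scope.
Variable f : C -> C.
Hypotheses (Cf : forall z, continuous f z) (Xf : forall z, X z -> X (f z)).

Lemma is_path_act a b g : f a = a -> f b = b -> is_path X a b g -> is_path X a b (act f g).
Proof.
intros Ha Hb (Cg & Xg & g0 & g1); split; [|unfold act; split; [auto|split; congruence]].
apply (continuous_on_comp unit_interval (fun _ => True) g f); auto.
apply continuous_on_forall; auto.
Qed.

Lemma path_homotopic_act a b g h : f a = a -> f b = b -> path_homotopic X a b g h ->
  path_homotopic X a b (act f g) (act f h).
Proof.
intros Fa Fb HH; destruct (path_homotopic_elim _ _ _ _ _ HH) as (H & HC & HX & Ha & Hb & Hg & Hh).
apply path_homotopic_intro with (fun s t => f (H s t)); unfold act; intros; rewrite ?Ha, ?Hb, ?Hg, ?Hh; auto.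
apply (continuous_comp (fun q : R * R => H (fst q) (snd q)) f); auto.
Qed.

Definition pact {a b} (Ha : f a = a) (Hb : f b = b) (p : path X a b) : path X a b :=
  Path _ (is_path_act _ _ _ Ha Hb (pfun_path p)).

#[global] Instance pact_proper a b Ha Hb : Proper (peq ==> peq) (@pact a b Ha Hb).
Proof. intros p q H; exact (path_homotopic_act _ _ _ _ Ha Hb H). Qed.

Lemma pact_cat a b c Ha Hb Hc (p : path X a b) (q : path X b c) :
  pact Ha Hc (p * q) == pact Ha Hb p * pact Hb Hc q.
Proof.
apply path_homotopic_ext; [apply pfun_path|]; intros t _; unfold act; simpl.
unfold path_concat, act; now destruct Rle_dec.
Qed.

Lemma pact_inv a b Ha Hb (p : path X a b) : pact Hb Ha p^-1 == (pact Ha Hb p)^-1.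
Proof. apply path_homotopic_ext; [apply pfun_path|]; intros t _; reflexivity. Qed.

Lemma pact_fix a b Ha Hb (p : path X a b) : (forall t, unit_interval t -> f (pfun p t) = pfun p t) ->
  pact Ha Hb p == p.
Proof. intros H; apply path_homotopic_ext; [apply pfun_path|]; exact H. Qed.

Lemma pact_conj a b Ha Hb (p : path X a b) (q : path X b b) :
  pact Ha Ha (p * q * p^-1) == pact Ha Hb p * pact Hb Hb q * (pact Ha Hb p)^-1.
Proof. now rewrite (pact_cat _ _ _ Ha Hb Ha), pact_inv, (pact_cat _ _ _ Ha Hb Hb). Qed.
End Action.

(** A full turn made gradually along a segment can be made at either end of it. *)
Lemma swirl z w th :
  (forall t, continuous th t) ->
  (forall t x, unit_interval t -> X (segment z w t * cis x)%C) ->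
  forall j : nat, th 0 = 2 * PI * INR j -> th 1 = 2 * PI * INR (S j) ->
  path_homotopic X z w (fun t => segment z w t * cis (th t))%C
    (path_concat (fun t => z * cis (2 * PI * t))%C (segment z w)) /\
  path_homotopic X z w (fun t => segment z w t * cis (th t))%C
    (path_concat (segment z w) (fun t => w * cis (2 * PI * t))%C).
Proof.
intros Cth HX j H0 H1.
(* Unrolls the motion: position along the segment and angle become independent coordinates on a
   convex strip, where turning gradually, turning first and turning last are homotopic. *)
set (f := fun q : C => (segment z w (fst q) * cis (snd q))%C).
assert (Cj : forall k, cis (2 * PI * INR k) = RtoC 1) by apply cis_nat.
assert (Cj' : forall k t, cis (2 * PI * INR k + t) = cis t) by (intros; rewrite cis_add, Cj; ring).
assert (E0 : f (0, 2 * PI * INR j) = z) by (unfold f; simpl; rewrite Cj, segment_0; ring).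
assert (E1 : f (1, 2 * PI * INR (S j)) = w) by (unfold f; cbn [fst snd]; rewrite Cj, segment_1; ring).
assert (HS : 2 * PI * INR (S j) = 2 * PI * INR j + 2 * PI) by (rewrite S_INR; ring).
assert (HW : convex (fun q => 0 <= fst q <= 1)) by apply convex_strip.
assert (Cf : forall q, continuous f q) by (intros q; unfold f, segment; cont).
assert (Xf : forall q, 0 <= fst q <= 1 -> X (f q)) by (intros q Hq; now apply HX).
assert (P : is_path (fun q : C => 0 <= fst q <= 1) (0, 2 * PI * INR j) (1, 2 * PI * INR (S j))
  (fun t => (t, th t))).
{ apply is_path_intro; [cont|simpl; auto| |]; now rewrite ?H0, ?H1. }
split.
- assert (P' : is_path (fun q : C => 0 <= fst q <= 1) (0, 2 * PI * INR j) (1, 2 * PI * INR (S j))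
    (path_concat (fun t => (0, 2 * PI * INR j + 2 * PI * t)) (fun t => (t, 2 * PI * INR (S j))))).
  { apply is_path_concat with (0, 2 * PI * INR (S j)).
    * apply is_path_intro; [cont|simpl; intros; lra| |]; apply injective_projections; cbn [fst snd]; lra.
    * apply is_path_intro; [cont|simpl; auto| |]; apply injective_projections; cbn [fst snd]; lra. }
  pose proof (path_homotopic_convex _ X f _ _ _ _ HW Cf Xf P P') as H; rewrite E0, E1 in H.
  apply path_homotopic_cast with (1 := H); [reflexivity|].
  intros t Ht; rewrite path_concat_map; apply path_concat_ext; auto; intros s _; unfold f; cbn [fst snd].
  + now rewrite segment_0, Cj'.
  + rewrite Cj; ring.
- assert (P' : is_path (fun q : C => 0 <= fst q <= 1) (0, 2 * PI * INR j) (1, 2 * PI * INR (S j))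
    (path_concat (fun t => (t, 2 * PI * INR j)) (fun t => (1, 2 * PI * INR j + 2 * PI * t)))).
  { apply is_path_concat with (1, 2 * PI * INR j).
    * apply is_path_intro; [cont|simpl; auto| |]; apply injective_projections; cbn [fst snd]; lra.
    * apply is_path_intro; [cont|simpl; intros; lra| |]; apply injective_projections; cbn [fst snd]; lra. }
  pose proof (path_homotopic_convex _ X f _ _ _ _ HW Cf Xf P P') as H; rewrite E0, E1 in H.
  apply path_homotopic_cast with (1 := H); [reflexivity|].
  intros t Ht; rewrite path_concat_map; apply path_concat_ext; auto; intros s _; unfold f; cbn [fst snd].
  + rewrite Cj; ring.
  + now rewrite segment_1, Cj'.
Qed.

(** A rotation angle with the same values as that of [beta] on the circles
    through [K] and on the boundary, but constant near the loops chosen around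
    the points of [K]. *)
Definition psi (w : R) : R :=
  2 * PI * clamp ((16 - w) / 7) + 2 * PI * clamp ((18 / 10 - w) * (100 / 11)).

(** The thresholds fit the chosen polygons: 169/100 is the squared radius of [pm] and of the other
    vertices of the inner loops; on the loop around 2 the squared radius ranges from 18/10, attained
    between [pG] and [pn], to 9. The divisors 7 and 11/100 are the widths of the two transition
    zones. *)
Lemma psi_inner w : w <= 169 / 100 -> psi w = 4 * PI.
Proof. intros H; unfold psi; rewrite !clamp_ge by lra; ring. Qed.

Lemma psi_middle w : 18 / 10 <= w <= 9 -> psi w = 2 * PI.
Proof. intros H; unfold psi; rewrite clamp_ge, clamp_le by lra; ring. Qed.

Lemma psi_16 : psi 16 = 0.
Proof. unfold psi; rewrite !clamp_le by lra; ring. Qed.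

Lemma cont_psi w : continuous psi w.
Proof. unfold psi, Rdiv; cont. Qed.

Lemma cont_twist_psi z : continuous (twist psi) z.
Proof.
unfold twist; apply cont_Cmult; [cont|]; apply cont_cis.
apply (continuous_comp sqnorm psi); [apply (cont_sqnorm (fun z => z)); cont|apply cont_psi].
Qed.

Lemma punctured_twist_psi z : X z -> X (twist psi z).
Proof.
apply punctured_twist; [rewrite psi_inner by lra; apply cis_4PI|].
rewrite psi_middle by lra; apply cis_2PI.
Qed.

Lemma twist_psi_fix z : sqnorm z <= 169/100 \/ 18/10 <= sqnorm z <= 9 \/ sqnorm z = 16 ->
  twist psi z = z.
Proof.
unfold twist; intros [H|[H|H]]; [rewrite psi_inner, cis_4PI by auto|
  rewrite psi_middle, cis_2PI by auto|rewrite H, psi_16, cis_0]; ring.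
Qed.

Lemma beta_psi_homotopic g : is_loop X u0 g ->
  homotopic X u0 (act beta g) (act (twist psi) g).
Proof.
intros Hg; assert (E : beta u0 = u0) by (apply twist_id; rewrite sqnorm_u0; apply angle_16).
cut (path_homotopic X (beta u0) (beta u0) (act beta g) (act (twist psi) g)); [now rewrite E|].
apply (twist_homotopic (angle (4 * PI) (2 * PI)) psi u0 u0); auto.
- intros w; unfold angle, Rdiv; cont.
- apply cont_psi.
- rewrite angle_1; apply cis_4PI.
- rewrite angle_4; apply cis_2PI.
- rewrite angle_1, psi_inner; lra.
- rewrite angle_4, psi_middle; lra.
- now rewrite sqnorm_u0, angle_16, psi_16.
- now rewrite sqnorm_u0, angle_16, psi_16.
Qed.

Lemma peq_pfun {Y a b} (p q : path Y a b) : pfun p = pfun q -> peq p q.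
Proof. intros H; unfold peq; rewrite H; apply path_homotopic_refl, pfun_path. Qed.

(** The type of [pol] names its end as [last l a]; hypotheses on [pfun] let paths typed with the
    actual endpoint be joined. *)
Lemma pol_cat a l b l' c (p : path X a b) (q : path X b c) (r : path X a c) :
  pfun p = poly a l -> pfun q = poly b l' -> pfun r = poly a (l ++ l') ->
  last l a = b -> last l' b = c -> peq (pcat p q) r.
Proof.
intros Hp Hq Hr Hb Hc; unfold peq; rewrite Hr; simpl; rewrite Hp, Hq, <- Hc.
apply poly_app; auto; apply poly_in_of_image; [rewrite <- Hp|rewrite <- Hq]; apply pfun_path.
Qed.

Lemma punctured_radius z : sqnorm z <= 16 -> sqnorm z <> 1 -> sqnorm z <> 4 -> X z.
Proof.
intros H H1 H4; split; [now apply D_sqnorm|]; intros HK.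
destruct (K_fibre_sqnorm _ HK); auto.
Qed.

(** * Tails, loops and circles in the punctured disc *)

Ltac punctured_point := apply punctured_spec; points; lra.
Ltac polygon := cbn [poly_in]; repeat (split; [edge|]); punctured_point.

(** Its vertices separate the regimes of [psi]: the angle varies on the first and the last edge
    only, so the twist acts on each edge by a single turn or not at all. *)
Definition tail : path X u0 pm := pol X u0 [pn; pk; pm] ltac:(polygon).
Definition tail3 : path X u0 pn := pol X u0 [pn] ltac:(polygon).
Definition tail_back : path X pm u0 := pol X pm [pk; pn; u0] ltac:(polygon).
Definition tail3_back : path X pn u0 := pol X pn [u0] ltac:(polygon).
Definition loop1 : path X pm pm := pol X pm [pB; pA'; pm] ltac:(polygon).
Definition loop2 : path X pm pm := pol X pm [pA; pB; pm] ltac:(polygon).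
Definition loop3 : path X pn pn := pol X pn [pF; pG; pn] ltac:(polygon).

Lemma circle_in v : 0 <= sqnorm v <= 16 -> sqnorm v <> 1 -> sqnorm v <> 4 ->
  is_path X v v (fun t => v * cis (2 * PI * t))%C.
Proof.
intros Hv H1 H4; apply is_path_intro; [cont| | |].
- intros t _; apply punctured_radius; rewrite sqnorm_mult, sqnorm_cis, Rmult_1_r; lra.
- rewrite Rmult_0_r, cis_0; apply Cmult_1_r.
- rewrite Rmult_1_r, cis_2PI; apply Cmult_1_r.
Qed.

Definition circle_u0 : path X u0 u0 :=
  Path _ (circle_in u0 ltac:(points; lra) ltac:(points; lra) ltac:(points; lra)).
Definition circle_pm : path X pm pm :=
  Path _ (circle_in pm ltac:(points; lra) ltac:(points; lra) ltac:(points; lra)).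

Ltac eqC := apply injective_projections; unfold u0, pm, pA, pB, pA'; simpl; lra.

Lemma circle_square v a b c :
  a = (v * Ci)%C -> b = (- v)%C -> c = (- v * Ci)%C ->
  (forall z, 1 <= Rabs (fst z) + Rabs (snd z) -> sqnorm z <= 1 -> X (v * z)%C) ->
  path_homotopic X v v (fun t => v * cis (2 * PI * t))%C (poly v [a; b; c; v]).
Proof.
intros -> -> -> HX; pose proof (path_homotopic_circle X (RtoC 0) v) as H.
rewrite !Cplus_0_l in H.
replace (RtoC 0 - v)%C with (- v)%C in H by ring.
replace (RtoC 0 - v * Ci)%C with (- v * Ci)%C in H by ring.
apply path_homotopic_cast with (1 := H ltac:(intros z H1 H2; rewrite Cplus_0_l; auto)); auto.
intros; apply Cplus_0_l.
Qed.

Lemma circle_u0_square : path_homotopic X u0 u0 (pfun circle_u0) (poly u0 [(4, 0); (0, 4); (-4, 0); u0]).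
Proof.
apply circle_square; try eqC.
intros [x y] H1 H2; cbn [fst snd] in *.
(* Since |x| + |y| >= 1 forces |z|^2 >= 1/2, the caps stay outside the circles through K. *)
assert (H3 : 8 <= sqnorm (u0 * (x, y))).
{ rewrite sqnorm_mult, sqnorm_u0; unfold sqnorm; cbn [fst snd].
  rewrite <- (Rabs_pos_eq (x * x)), <- (Rabs_pos_eq (y * y)), !Rabs_mult by nra.
  pose proof (Rle_0_sqr (Rabs x - Rabs y)); unfold Rsqr in *; nra. }
apply punctured_radius; [rewrite sqnorm_mult, sqnorm_u0| |]; lra.
Qed.

Lemma circle_pm_square : path_homotopic X pm pm (pfun circle_pm) (poly pm [pA; pB; pA'; pm]).
Proof.
apply circle_square; try eqC.
intros [x y] H1 H2; cbn [fst snd] in *.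
(* Here the radius does not decide, as the caps reach inside the unit circle; but on the real axis x
   = 0, so |y| = 1 and only the points 13/10 and -13/10 remain. *)
apply punctured_spec; rewrite sqnorm_mult; split.
- unfold pm, sqnorm in *; simpl in *; nra.
- unfold pm, sqnorm in *; simpl in *; intros [Hx Hy].
  assert (x = 0) as -> by lra; rewrite Rabs_R0 in H1.
  revert H1; unfold Rabs; destruct Rcase_abs; intros; nra.
Qed.

Section Words.
Local Open Scope path_scope.

Lemma tail_inv : tail^-1 == tail_back.
Proof.
assert (H1 : segment_in X u0 pn) by edge. assert (H1' : segment_in X pn u0) by edge.
assert (H2 : segment_in X pn pk) by edge. assert (H2' : segment_in X pk pn) by edge.
assert (H3 : segment_in X pk pm) by edge. assert (H3' : segment_in X pm pk) by edge.
assert (X0 : X u0) by punctured_point. assert (Xm : X pm) by punctured_point.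
assert (tail == sg X _ _ H1 * (sg X _ _ H2 * sg X _ _ H3)) as ->.
{ rewrite <- (pcatp1 X _ _ Xm (sg X _ _ H3)); now apply peq_pfun. }
rewrite !pinvM, (pinv_sg X _ _ H1 H1'), (pinv_sg X _ _ H2 H2'), (pinv_sg X _ _ H3 H3').
rewrite <- (pcatp1 X _ _ X0 (sg X _ _ H1')), pcatA; now apply peq_pfun.
Qed.

Lemma tail3_inv : tail3^-1 == tail3_back.
Proof.
assert (H1 : segment_in X u0 pn) by edge. assert (H1' : segment_in X pn u0) by edge.
assert (X0 : X u0) by punctured_point. assert (Xn : X pn) by punctured_point.
assert (tail3 == sg X _ _ H1) as ->.
{ rewrite <- (pcatp1 X _ _ Xn (sg X _ _ H1)); now apply peq_pfun. }
rewrite (pinv_sg X _ _ H1 H1'), <- (pcatp1 X _ _ X0 (sg X _ _ H1')); now apply peq_pfun.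
Qed.

Definition lollipop1 := tail * loop1 * tail^-1.
Definition lollipop2 := tail * loop2 * tail^-1.
Definition lollipop3 := tail3 * loop3 * tail3^-1.
Definition inner_circle := tail * circle_pm * tail^-1.

Lemma lollipop1_polygon : path_homotopic X u0 u0 (pfun lollipop1) (poly u0 [pn; pk; pm; pB; pA'; pm; pk; pn; u0]).
Proof.
assert (H : poly_in X u0 [pn; pk; pm; pB; pA'; pm; pk; pn; u0]) by polygon.
change (lollipop1 == (pol X _ _ H : path X u0 u0)); unfold lollipop1; rewrite pcatA, tail_inv.
rewrite (pol_cat pm [pB; pA'; pm] pm [pk; pn; u0] u0 loop1 tail_back (pol X pm [pB; pA'; pm; pk; pn; u0] ltac:(polygon)) eq_refl eq_refl eq_refl eq_refl eq_refl).
now apply (pol_cat u0 [pn; pk; pm] pm [pB; pA'; pm; pk; pn; u0]).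
Qed.

Lemma lollipop2_polygon : path_homotopic X u0 u0 (pfun lollipop2) (poly u0 [pn; pk; pm; pA; pB; pm; pk; pn; u0]).
Proof.
assert (H : poly_in X u0 [pn; pk; pm; pA; pB; pm; pk; pn; u0]) by polygon.
change (lollipop2 == (pol X _ _ H : path X u0 u0)); unfold lollipop2; rewrite pcatA, tail_inv.
rewrite (pol_cat pm [pA; pB; pm] pm [pk; pn; u0] u0 loop2 tail_back (pol X pm [pA; pB; pm; pk; pn; u0] ltac:(polygon)) eq_refl eq_refl eq_refl eq_refl eq_refl).
now apply (pol_cat u0 [pn; pk; pm] pm [pA; pB; pm; pk; pn; u0]).
Qed.

Lemma lollipop3_polygon : path_homotopic X u0 u0 (pfun lollipop3) (poly u0 [pn; pF; pG; pn; u0]).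
Proof.
assert (H : poly_in X u0 [pn; pF; pG; pn; u0]) by polygon.
change (lollipop3 == (pol X _ _ H : path X u0 u0)); unfold lollipop3; rewrite pcatA, tail3_inv.
rewrite (pol_cat pn [pF; pG; pn] pn [u0] u0 loop3 tail3_back (pol X pn [pF; pG; pn; u0] ltac:(polygon)) eq_refl eq_refl eq_refl eq_refl eq_refl).
now apply (pol_cat u0 [pn] pn [pF; pG; pn; u0]).
Qed.

Lemma inner_circle_word : inner_circle == lollipop2 * lollipop1.
Proof.
assert (circle_pm == loop2 * loop1) as E.
{ pose proof (proj2 (proj2 polygon_12) ltac:(polygon)) as H.
  transitivity (pol X pm [pA; pB; pm; pB; pA'; pm] ltac:(polygon) : path X pm pm).
  - exact (path_homotopic_trans _ _ _ _ _ _ circle_pm_square (path_homotopic_sym _ _ _ _ _ H)).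
  - symmetry; now apply (pol_cat pm [pA; pB; pm] pm [pB; pA'; pm]). }
unfold inner_circle, lollipop1, lollipop2; rewrite E; repeat rewrite pcatA; now rewrite pcatVK.
Qed.

Lemma circle_u0_word : circle_u0 == lollipop3 * inner_circle.
Proof.
assert (HS : poly_in X u0 [pn; pk; pm; pA; pB; pA'; pm; pk; pn; u0]) by polygon.
assert (ES : inner_circle == (pol X _ _ HS : path X u0 u0)).
{ unfold inner_circle; rewrite pcatA, tail_inv.
  set (sq := pol X pm [pA; pB; pA'; pm] ltac:(polygon) : path X pm pm).
  assert (circle_pm == sq) as -> by exact circle_pm_square.
  rewrite (pol_cat pm [pA; pB; pA'; pm] pm [pk; pn; u0] u0 sq tail_back
    (pol X pm [pA; pB; pA'; pm; pk; pn; u0] ltac:(polygon)) eq_refl eq_refl eq_refl eq_refl eq_refl).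
  now apply (pol_cat u0 [pn; pk; pm] pm [pA; pB; pA'; pm; pk; pn; u0]). }
assert (H3 : poly_in X u0 [pn; pF; pG; pn; u0]) by polygon.
assert (E3 : lollipop3 == (pol X _ _ H3 : path X u0 u0)) by exact lollipop3_polygon.
rewrite ES, E3.
pose proof (proj2 (proj2 polygon_123) ltac:(polygon)) as H.
transitivity (pol X u0 [pn; pF; pG; pn; u0; pn; pk; pm; pA; pB; pA'; pm; pk; pn; u0] ltac:(polygon) : path X u0 u0).
- exact (path_homotopic_trans _ _ _ _ _ _ circle_u0_square (path_homotopic_sym _ _ _ _ _ H)).
- symmetry; now apply (pol_cat u0 [pn; pF; pG; pn; u0] u0 [pn; pk; pm; pA; pB; pA'; pm; pk; pn; u0]).
Qed.

End Words.

(** * Tails and loops under the twist *)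

Lemma fix_u0 : twist psi u0 = u0.
Proof. apply twist_psi_fix; points; lra. Qed.
Lemma fix_pn : twist psi pn = pn.
Proof. apply twist_psi_fix; points; lra. Qed.
Lemma fix_pk : twist psi pk = pk.
Proof. apply twist_psi_fix; points; lra. Qed.
Lemma fix_pm : twist psi pm = pm.
Proof. apply twist_psi_fix; points; lra. Qed.

Lemma beta_u0 : beta u0 = u0.
Proof. apply twist_id; rewrite sqnorm_u0; apply angle_16. Qed.

Lemma continuous_beta z : continuous beta z.
Proof. unfold beta; apply (cont_twist_angle (fun _ => 4 * PI) (fun _ => 2 * PI) (fun z => z)); cont. Qed.

Lemma punctured_beta z : X z -> X (beta z).
Proof. apply punctured_twist; rewrite ?angle_1, ?angle_4; auto using cis_2PI, cis_4PI. Qed.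


Definition psi_act {a b} (Ha : twist psi a = a) (Hb : twist psi b = b) : path X a b -> path X a b :=
  pact (twist psi) cont_twist_psi punctured_twist_psi Ha Hb.
Definition beta_act : path X u0 u0 -> path X u0 u0 :=
  pact beta continuous_beta punctured_beta beta_u0 beta_u0.

Lemma poly_fix a l :
  twist psi a = a ->
  (fix ok a l := match l with [] => True | b :: l =>
     (forall t, unit_interval t -> twist psi (segment a b t) = segment a b t) /\ ok b l end) a l ->
  forall t, unit_interval t -> twist psi (poly a l t) = poly a l t.
Proof.
intros Ha; revert a Ha; induction l as [|b l IH]; intros a Ha Hl t [H0 H1]; simpl; auto.
destruct Hl as [Hab Hl]; unfold path_concat; destruct Rle_dec.
- apply Hab; unfold unit_interval; lra.
- apply IH; auto; [|unfold unit_interval; lra].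
  rewrite <- (segment_1 a b); auto.
Qed.

Ltac segment_radius := intros t [? ?]; apply twist_psi_fix; unfold segment; points; simpl.

Lemma loop1_fix : (psi_act fix_pm fix_pm loop1 == loop1)%path.
Proof.
apply pact_fix, poly_fix; [apply fix_pm|].
repeat split; auto; segment_radius; left; nra.
Qed.

Lemma loop2_fix : (psi_act fix_pm fix_pm loop2 == loop2)%path.
Proof.
apply pact_fix, poly_fix; [apply fix_pm|].
repeat split; auto; segment_radius; left; nra.
Qed.

Lemma loop3_fix : (psi_act fix_pn fix_pn loop3 == loop3)%path.
Proof.
apply pact_fix, poly_fix; [apply fix_pn|].
(* On the edge from [pG] to [pn] the squared radius is 20 (t - 2/5)^2 + 18/10, so the bound is sharp
   there. *)
repeat split; auto; segment_radius; right; left;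
  (assert (0 <= t * (1 - t)) by nra); pose proof (Rle_0_sqr (t - 2/5)); unfold Rsqr in *; split; nra.
Qed.

Lemma segment_u0_pn t : sqnorm (segment u0 pn t) = (4 - t) * (4 - t).
Proof. unfold segment; points; simpl; ring. Qed.

Lemma segment_pk_pm t : sqnorm (segment pk pm t) = (135/100 - 5/100 * t) * (135/100 - 5/100 * t).
Proof. unfold segment; points; simpl; field. Qed.

Section Words.
Local Open Scope path_scope.

Lemma psi_act_tail3 : psi_act fix_u0 fix_pn tail3 == circle_u0 * tail3.
Proof.
assert (H : segment_in X u0 pn) by edge.
assert (tail3 == sg X _ _ H) as ->.
{ symmetry; exact (path_homotopic_segment_poly X u0 pn H). }
(* The angle grows from 0 at [u0] to 2 pi at [pn], hence j = 0; the turn is made at [u0]. *)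
destruct (swirl u0 pn (fun t => psi (sqnorm (segment u0 pn t)))) with (j := 0%nat) as [HS _].
- intros t; apply (continuous_comp (fun t => sqnorm (segment u0 pn t)) psi); [|apply cont_psi].
  apply cont_sqnorm; unfold segment; cont.
- intros t x [? ?]; apply punctured_radius; rewrite sqnorm_mult, sqnorm_cis, segment_u0_pn; nra.
- rewrite segment_u0_pn; replace ((4 - 0) * (4 - 0))%R with 16 by ring; rewrite psi_16; simpl; ring.
- rewrite segment_u0_pn, psi_middle by lra; simpl; ring.
- exact HS.
Qed.

Lemma psi_act_tail : psi_act fix_u0 fix_pm tail == circle_u0 * tail * circle_pm.
Proof.
assert (H1 : segment_in X u0 pn) by edge.
assert (H2 : segment_in X pn pk) by edge.
assert (H3 : segment_in X pk pm) by edge.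
assert (Xm : X pm) by punctured_point. assert (Xn : X pn) by punctured_point.
assert (tail == tail3 * (sg X _ _ H2 * sg X _ _ H3)) as ->.
{ assert (tail3 == sg X _ _ H1) as -> by (symmetry; exact (path_homotopic_segment_poly X u0 pn H1)).
  rewrite <- (pcatp1 X _ _ Xm (sg X _ _ H3)); now apply peq_pfun. }
unfold psi_act; rewrite (pact_cat _ _ _ _ _ _ _ fix_pn), (pact_cat _ _ _ _ _ _ _ fix_pk).
assert (pact (twist psi) cont_twist_psi punctured_twist_psi fix_u0 fix_pn tail3 == circle_u0 * tail3) as ->
  by exact psi_act_tail3.
assert (pact (twist psi) cont_twist_psi punctured_twist_psi fix_pn fix_pk (sg X _ _ H2) == sg X _ _ H2) as ->.
{ apply pact_fix; segment_radius; right; left; split; nra. }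
assert (pact (twist psi) cont_twist_psi punctured_twist_psi fix_pk fix_pm (sg X _ _ H3) == sg X _ _ H3 * circle_pm) as ->.
(* The angle grows from 2 pi to 4 pi, hence j = 1; this turn is made at the inner end [pm]. *)
{ destruct (swirl pk pm (fun t => psi (sqnorm (segment pk pm t)))) with (j := 1%nat) as [_ HS].
  - intros t; apply (continuous_comp (fun t => sqnorm (segment pk pm t)) psi); [|apply cont_psi].
    apply cont_sqnorm; unfold segment; cont.
  - intros t x [? ?]; apply punctured_radius; rewrite sqnorm_mult, sqnorm_cis, segment_pk_pm; nra.
  - rewrite segment_pk_pm, psi_middle by lra; simpl; ring.
  - rewrite segment_pk_pm, psi_inner by lra; simpl; ring.
  - exact HS. }
repeat rewrite pcatA; reflexivity.
Qed.

Lemma beta_act_psi (p : path X u0 u0) : beta_act p == psi_act fix_u0 fix_u0 p.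
Proof. exact (beta_psi_homotopic _ (pfun_path p)). Qed.

Lemma beta_act_x3 (x1 x2 x3 : path X u0 u0) : x1 == lollipop1 -> x2 == lollipop2 -> x3 == lollipop3 ->
  beta_act x3 == x3 * (x2 * x1) * x3 * (x3 * (x2 * x1))^-1.
Proof.
intros E1 E2 E3.
assert (ED : x3 * (x2 * x1) == circle_u0) by now rewrite circle_u0_word, inner_circle_word, E1, E2, E3.
rewrite !ED, beta_act_psi, !E3; unfold lollipop3, psi_act; rewrite (pact_conj _ _ _ _ _ _ fix_pn).
fold (psi_act fix_u0 fix_pn tail3); fold (psi_act fix_pn fix_pn loop3).
rewrite psi_act_tail3, loop3_fix, pinvM.
repeat rewrite pcatA; reflexivity.
Qed.

(** The circle at [pm] acquired by the tail, carried back to [u0] along the tail, is [inner_circle],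
    that is s; with the boundary loop in front this gives conjugation by d s, for every inner loop
    fixed by the twist. *)
Lemma beta_act_inner (x1 x2 x3 : path X u0 u0) (l : path X pm pm) :
  x1 == lollipop1 -> x2 == lollipop2 -> x3 == lollipop3 -> psi_act fix_pm fix_pm l == l ->
  beta_act (tail * l * tail^-1) ==
  x3 * (x2 * x1) * (x2 * x1) * (tail * l * tail^-1) * (x3 * (x2 * x1) * (x2 * x1))^-1.
Proof.
intros E1 E2 E3 Hl.
assert (ED : x3 * (x2 * x1) == circle_u0) by now rewrite circle_u0_word, inner_circle_word, E1, E2, E3.
assert (ES : x2 * x1 == inner_circle) by now rewrite inner_circle_word, E1, E2.
rewrite !ED, !ES, beta_act_psi; unfold psi_act; rewrite (pact_conj _ _ _ _ _ _ fix_pm).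
fold (psi_act fix_u0 fix_pm tail); fold (psi_act fix_pm fix_pm l).
rewrite psi_act_tail, Hl; unfold inner_circle; rewrite !pinvM, pinvK.
repeat rewrite pcatA; repeat rewrite pcatVK; reflexivity.
Qed.

End Words.

(** * Identification of the g-base and comparison of the relations *)

Lemma gbase_polygon p r l : p = -1 \/ p = 1 \/ p = 2 -> 0 < r < 1/2 ->
  poly_eq X u0 l (gbase_square p) ->
  path_homotopic X u0 u0 (gbase_loop r (RtoC p)) (poly u0 l).
Proof.
intros Hp Hr Hl; pose proof (gbase_loop_square p Hp r Hr) as H; cbv zeta in H.
apply path_homotopic_trans with (1 := H).
apply path_homotopic_is_path in H as [_ H].
replace (RtoC p + RtoC (1 / 100) * (u0 - RtoC p))%C with (sq0 p) in *
  by (apply injective_projections; simpl; field).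
replace (RtoC p + RtoC (1 / 100) * (u0 - RtoC p) * Ci)%C with (sq1 p) in *
  by (apply injective_projections; simpl; field).
replace (RtoC p - RtoC (1 / 100) * (u0 - RtoC p))%C with (sq2 p) in *
  by (apply injective_projections; simpl; field).
replace (RtoC p - RtoC (1 / 100) * (u0 - RtoC p) * Ci)%C with (sq3 p) in *
  by (apply injective_projections; simpl; field).
apply (proj2 (proj2 (poly_eq_sym _ _ _ _ Hl))), poly_in_of_image, H.
Qed.

Lemma gbase_lollipop1 r : 0 < r < 1/2 -> path_homotopic X u0 u0 (gbase_loop r (RtoC (-1))) (pfun lollipop1).
Proof.
intros Hr; apply path_homotopic_trans with (2 := path_homotopic_sym _ _ _ _ _ lollipop1_polygon).
apply gbase_polygon; auto; exact polygon_1.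
Qed.

Lemma gbase_lollipop2 r : 0 < r < 1/2 -> path_homotopic X u0 u0 (gbase_loop r (RtoC 1)) (pfun lollipop2).
Proof.
intros Hr; apply path_homotopic_trans with (2 := path_homotopic_sym _ _ _ _ _ lollipop2_polygon).
apply gbase_polygon; auto; exact polygon_2.
Qed.

Lemma gbase_lollipop3 r : 0 < r < 1/2 -> path_homotopic X u0 u0 (gbase_loop r (RtoC 2)) (pfun lollipop3).
Proof.
intros Hr; apply path_homotopic_trans with (2 := path_homotopic_sym _ _ _ _ _ lollipop3_polygon).
apply gbase_polygon; auto; exact polygon_3.
Qed.

Lemma ordered_points p : ordered_real_points 3 K_fibre p ->
  p 1%nat = -1 /\ p 2%nat = 1 /\ p 3%nat = 2.
Proof.
intros [Hlt HK].
pose proof (Hlt 1%nat 2%nat ltac:(lia) ltac:(lia) ltac:(lia)).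
pose proof (Hlt 2%nat 3%nat ltac:(lia) ltac:(lia) ltac:(lia)).
assert (Hp : forall i, (1 <= i <= 3)%nat -> p i = -1 \/ p i = 1 \/ p i = 2).
{ intros i Hi; assert (HKi : K_fibre (RtoC (p i))) by (apply HK; eauto).
  apply K_fibre_spec in HKi as [E|[E|E]]; apply RtoC_inj in E; auto. }
destruct (Hp 1%nat ltac:(lia)) as [?|[?|?]]; destruct (Hp 2%nat ltac:(lia)) as [?|[?|?]];
  destruct (Hp 3%nat ltac:(lia)) as [?|[?|?]]; lra.
Qed.

Lemma small_radius_lt r : small_radius K_fibre r -> 0 < r < 1/2.
Proof.
intros (Hr & _ & H).
specialize (H (RtoC 2) (RtoC 1)); rewrite !K_fibre_spec in H.
assert (N : RtoC 2 <> RtoC 1) by (intros E; apply RtoC_inj in E; lra).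
specialize (H ltac:(auto) ltac:(auto) N); rewrite <- RtoC_minus, Cmod_R in H.
replace (2 - 1) with 1 in H by lra; rewrite Rabs_R1 in H; lra.
Qed.

Section Relations.
Local Open Scope path_scope.
Variables (x : nat -> R -> C) (x1 x2 x3 : path X u0 u0).
Hypotheses (Ex1 : x 1%nat = pfun x1) (Ex2 : x 2%nat = pfun x2) (Ex3 : x 3%nat = pfun x3).
Hypotheses (E1 : x1 == lollipop1) (E2 : x2 == lollipop2) (E3 : x3 == lollipop3).
Let e := x3 * (x2 * x1) * (x2 * x1).

Lemma beta_act_x1 : beta_act x1 == e * x1 * e^-1.
Proof.
transitivity (beta_act lollipop1); [now apply pact_proper|].
unfold lollipop1; rewrite (beta_act_inner x1 x2 x3 loop1 E1 E2 E3 loop1_fix).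
fold lollipop1; now rewrite <- E1.
Qed.

Lemma beta_act_x2 : beta_act x2 == e * x2 * e^-1.
Proof.
transitivity (beta_act lollipop2); [now apply pact_proper|].
unfold lollipop2; rewrite (beta_act_inner x1 x2 x3 loop2 E1 E2 E3 loop2_fix).
fold lollipop2; now rewrite <- E2.
Qed.

(** The formulas for [beta_act] turn the induced relators into commutation relations with [d] and
    [e]; each inclusion is then the algebra of these relations in the quotient by the other
    family. *)
Lemma stated_relators_normal_closure :
  same_normal_closure X u0 (induced_relators 3 beta x) (stated_relators x).
Proof.
assert (Xu : X u0) by punctured_point.
set (P := induced_relators 3 beta x); set (Q := stated_relators x).
pose proof (beta_act_x3 x1 x2 x3 E1 E2 E3) as B3.
pose proof beta_act_x1 as B1; pose proof beta_act_x2 as B2.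
assert (HP : forall R p q q', p == q -> neq X u0 R q q' -> neq X u0 R p q').
{ intros R p q q' H H'.
  apply (@Equivalence_Transitive _ _ (neq_equivalence X u0 R Xu)) with q; auto.
  now apply neq_of_peq. }
intros g; split; apply normal_closure_sub; clear g; intros g Hg HgP.
- destruct (induced_of_stated X u0 Q Xu x1 x2 x3) as (I3 & I1 & I2).
  + apply nc_gen; [apply (pfun_path (x3 * x2 * x1 * (x2 * x1 * x3)^-1))|].
    left; now rewrite Ex1, Ex2, Ex3.
  + apply nc_gen; [apply (pfun_path (x3 * x2 * x1 * x2 * x1 * (x1 * x3 * x2 * x1 * x2)^-1))|].
    right; now rewrite Ex1, Ex2, Ex3.
  + destruct HgP as (j & Hj & ->); destruct (index_cases j Hj) as [->|[->| ->]].
    * rewrite Ex1; exact (HP Q _ _ _ B1 I1).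
    * rewrite Ex2; exact (HP Q _ _ _ B2 I2).
    * rewrite Ex3; exact (HP Q _ _ _ B3 I3).
- assert (I3 : neq X u0 P (beta_act x3) x3).
  { apply nc_gen; [apply (pfun_path (beta_act x3 * x3^-1))|].
    exists 3%nat; split; [lia|now rewrite Ex3]. }
  assert (I1 : neq X u0 P (beta_act x1) x1).
  { apply nc_gen; [apply (pfun_path (beta_act x1 * x1^-1))|].
    exists 1%nat; split; [lia|now rewrite Ex1]. }
  symmetry in B1, B3.
  destruct (stated_of_induced X u0 P Xu x1 x2 x3 (HP P _ _ _ B3 I3) (HP P _ _ _ B1 I1)) as [S1 S2].
  unfold Q, stated_relators in HgP; rewrite Ex1, Ex2, Ex3 in HgP.
  destruct HgP as [->| ->]; [exact S1|exact S2].
Qed.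
End Relations.

Theorem theorem4p4 :
  exists beta : C -> C,
    braid_rep K_fibre beta /\
    (forall b : C -> C, local_braid_monodromy 3 S_curve b <-> same_braid K_fibre b beta) /\
    (forall b : C -> C, induced_braid 3 K_fibre twist_motion b <-> same_braid K_fibre b beta) /\
    (forall (p : nat -> R) (r : R),
       ordered_real_points 3 K_fibre p -> small_radius K_fibre r ->
       let x := fun j : nat => gbase_loop r (RtoC (p j)) in
       same_normal_closure (punctured K_fibre) u0
         (induced_relators 3 beta x) (stated_relators x)).
Proof.
exists beta; split; [exact braid_rep_beta|].
split; [exact local_braid_monodromy_beta|].
split; [exact induced_braid_twist_motion_beta|].
intros p r Hp Hr x.
apply ordered_points in Hp as (P1 & P2 & P3); apply small_radius_lt in Hr.
pose proof (gbase_lollipop1 r Hr) as H1; pose proof (gbase_lollipop2 r Hr) as H2; pose proof (gbase_lollipop3 r Hr) as H3.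
apply (stated_relators_normal_closure x
  (Path _ (proj1 (path_homotopic_is_path _ _ _ _ _ H1)))
  (Path _ (proj1 (path_homotopic_is_path _ _ _ _ _ H2)))
  (Path _ (proj1 (path_homotopic_is_path _ _ _ _ _ H3)))); auto; unfold x; now rewrite ?P1, ?P2, ?P3.
Qed.
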